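(* Let $k$ be a field, $R=k[x,y,z]$, and fix an integer $n\ge 4$. Let $J$ be a grade $3$ homogeneous ideal of $R$ with graded Betti numbers $\beta_{1,2}=1$, $\beta_{1,n+1}=2$, $\beta_{1,n+3}=1$, $\beta_{1,2n+4}=1$, $\beta_{2,n+2}=2$, $\beta_{2,n+4}=1$, $\beta_{2,2n+3}=1$, $\beta_{2,2n+6}=2$, $\beta_{2,3n+4}=1$, $\beta_{3,2n+4}=\beta_{3,2n+7}=\beta_{3,3n+5}=1$, and $\beta_{i,j}(R/J)=0$ for all other $i\ge1$ and all $j$. Consider the monomial ideal \[J'=(x^2,\ y^{2n+1},\ z^{2n+4},\ y^nz,\ xy^{n-1}z,\ xyz^{n+1}).\] Then $J'$ is sequentially bounded licci and $R/J'$ has the same Hilbert function as $R/J$.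
   Context: $R$ has the standard grading; $\beta_{i,j}(R/J)=\dim_k\operatorname{Tor}_i^R(R/J,k)_j$. A homogeneous complete intersection of grade $g$ is an ideal generated by a regular sequence of homogeneous forms $f_1,\dots,f_g$ with $\deg f_1\le\dots\le\deg f_g$; its type is $(\deg f_1,\dots,\deg f_g)$, and types are compared componentwise. Homogeneous ideals $I,I'$ of grade $g$ are directly linked by a homogeneous complete intersection $C$ of grade $g$ if $I=C:I'$ and $I'=C:I$. A homogeneous perfect ideal $I$ is sequentially bounded licci (SBL) if there is a finite sequence of direct links $I=I_0\sim_{C_0}I_1\sim\cdots\sim_{C_{s-1}}I_s$ with each $C_i$ a homogeneous complete intersection, $I_s$ a complete intersection, and $\operatorname{type}(C_i)\ge\operatorname{type}(C_{i+1})$ componentwise for all $i$. *)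

(* Defs.v *)
From mathcomp Require Import all_boot all_algebra.
From mathcomp Require Export mpoly.

Set Implicit Arguments.
Unset Strict Implicit.
Unset Printing Implicit Defensive.

Import GRing.Theory.
Local Open Scope ring_scope.

Section Defs.
Variable k : fieldType.

Notation R := {mpoly k[3]}.
Notation V3 := {ffun 'I_3 -> R}.

Definition vx : R := 'X_(ord0 : 'I_3).
Definition vy : R := 'X_(inord 1 : 'I_3).
Definition vz : R := 'X_(ord_max : 'I_3).

(* homogeneous of degree d (total degree); 0 is homogeneous of every degree *)
Definition hom (d : nat) (p : R) : bool := p \is @ishomog1 3 k d mdeg.
Definition homv (d : nat) (v : V3) : Prop := forall t, hom d (v t).

Definition hcomp (d : nat) (p : R) : R :=
  \sum_(m <- msupp p | mdeg m == d) p@_m *: 'X_[m].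

Definition pdeg (p : R) : nat := (msize p).-1.

Definition rel_indep (V : lmodType k) (A B : V -> Prop) (n : nat) (s : 'I_n -> V) :=
  (forall i, A (s i)) /\
  (forall c : 'I_n -> k, B (\sum_(i < n) c i *: s i) -> forall i, c i = 0).

(* dim_k (A / B) = m  (for subspaces B <= A) *)
Definition dim_mod (V : lmodType k) (A B : V -> Prop) (m : nat) : Prop :=
  (exists s : 'I_m -> V, rel_indep A B s) /\
  (forall n (s : 'I_n -> V), rel_indep A B s -> (n <= m)%N).

Definition is_ideal (I : R -> Prop) : Prop :=
  I 0 /\ (forall f g, I f -> I g -> I (f + g)) /\ (forall f g, I g -> I (f * g)).

Definition homog_ideal (I : R -> Prop) : Prop :=
  is_ideal I /\ (forall f d, I f -> I (hcomp d f)).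

Definition eqI (I I' : R -> Prop) : Prop := forall f, I f <-> I' f.

Definition gen (fs : seq R) : R -> Prop :=
  fun p => exists cs : 'I_(size fs) -> R, p = \sum_(i < size fs) cs i * fs`_i.

Definition colon (C I : R -> Prop) : R -> Prop :=
  fun f => forall h, I h -> C (f * h).

Definition regular (fs : seq R) : Prop :=
  ~ gen fs 1 /\
  (forall i, (i < size fs)%N -> forall g, gen (take i fs) (fs`_i * g) -> gen (take i fs) g).

Definition grade (I : R -> Prop) (g : nat) : Prop :=
  ~ I 1 /\
  (exists fs, size fs = g /\ regular fs /\ (forall f, f \in fs -> I f)) /\
  (forall fs, regular fs -> (forall f, f \in fs -> I f) -> (size fs <= g)%N).

(* beta_{i,j}(R/J) = dim_k Tor_i^R(R/J,k)_j = dim_k H_i(K(x,y,z) (x) R/J)_j *)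
(* K_0 = R, K_1 = R^3 (e1,e2,e3), K_2 = R^3 (e23,e13,e12), K_3 = R (e123)    *)
Definition tr (a b c : R) : V3 := [ffun i : 'I_3 => nth 0 [:: a; b; c] i].
Definition c0 (v : V3) := v ord0.
Definition c1 (v : V3) := v (inord 1).
Definition c2 (v : V3) := v ord_max.

Definition kd1 (v : V3) : R := vx * c0 v + vy * c1 v + vz * c2 v.
Definition kd2 (u : V3) : V3 :=
  tr (- (vz * c1 u) - vy * c2 u) (- (vz * c0 u) + vx * c2 u) (vy * c0 u + vx * c1 u).
Definition kd3 (t : R) : V3 := tr (vx * t) (- (vy * t)) (vz * t).

Definition betti (J : R -> Prop) (i j : nat) (m : nat) : Prop :=
  if (j < i)%N then m = 0%N else
  let e := (j - i)%N in
  match i with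
  | 0 => dim_mod (fun u : R => hom e u)
                 (fun u : R => hom e u /\ exists w : V3, J (u - kd1 w)) m
  | 1 => dim_mod (fun v : V3 => homv e v /\ J (kd1 v))
                 (fun v : V3 => homv e v /\ exists w : V3, forall t, J ((v - kd2 w) t)) m
  | 2 => dim_mod (fun u : V3 => homv e u /\ forall t, J (kd2 u t))
                 (fun u : V3 => homv e u /\ exists w : R, forall t, J ((u - kd3 w) t)) m
  | 3 => dim_mod (fun w : R => hom e w /\ forall t, J (kd3 w t))
                 (fun w : R => hom e w /\ J w) m
  | _ => m = 0%N
  end.

Definition hilb (I : R -> Prop) (d m : nat) : Prop :=
  dim_mod (fun p : R => hom d p) I m.

(* perfect: grade I = pd_R(R/I), where pd_R(R/I) = max{ i | beta_{i,j}(R/I) <> 0 } *)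
Definition perfect (I : R -> Prop) : Prop :=
  homog_ideal I /\
  exists g, grade I g /\ (exists j m, (0 < m)%N /\ betti I g j m) /\
            (forall i j, (g < i)%N -> betti I i j 0).

Definition hci (fs : seq R) (g : nat) : Prop :=
  size fs = g /\ regular fs /\ (forall f, f \in fs -> f \is @ishomog 3 k mdeg) /\
  sorted leq (map pdeg fs).

Definition ci_type (fs : seq R) : seq nat := map pdeg fs.

Definition linked (I I' : R -> Prop) (fs : seq R) (g : nat) : Prop :=
  homog_ideal I /\ homog_ideal I' /\ grade I g /\ grade I' g /\
  hci fs g /\ eqI I (colon (gen fs) I') /\ eqI I' (colon (gen fs) I).

Definition SBL (I : R -> Prop) : Prop :=
  perfect I /\
  exists (g s : nat) (Is : nat -> R -> Prop) (Cs : nat -> seq R),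
    eqI (Is 0%N) I /\
    (forall t, (t < s)%N -> linked (Is t) (Is t.+1) (Cs t) g) /\
    (exists fs, hci fs g /\ eqI (Is s) (gen fs)) /\
    (forall t, (t.+1 < s)%N -> forall l, (l < g)%N ->
        (nth 0%N (ci_type (Cs t.+1)) l <= nth 0%N (ci_type (Cs t)) l)%N).

Definition betti_table (n i j : nat) : nat :=
  match i with
  | 1 => if j == 2 then 1 else if j == n + 1 then 2 else if j == n + 3 then 1
         else if j == 2 * n + 4 then 1 else 0
  | 2 => if j == n + 2 then 2 else if j == n + 4 then 1 else if j == 2 * n + 3 then 1
         else if j == 2 * n + 6 then 2 else if j == 3 * n + 4 then 1 else 0
  | 3 => if j == 2 * n + 4 then 1 else if j == 2 * n + 7 then 1
         else if j == 3 * n + 5 then 1 else 0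
  | _ => 0
  end%N.

Definition Jprime_gens (n : nat) : seq R :=
  [:: vx ^+ 2; vy ^+ (2 * n + 1); vz ^+ (2 * n + 4); vy ^+ n * vz;
      vx * vy ^+ (n - 1) * vz; vx * vy * vz ^+ (n + 1)].

End Defs.

(* Main.v *)
(* R/J' has finite length and all the links are monomial.  Linking a monomial ideal I by
   C = (x^a, y^b, z^c) replaces the set of standard monomials of I by the reflection of
   its complement in the box [0,a) x [0,b) x [0,c); starting from J', four such steps
   with decreasing boxes end at (x, y^(n-2), z^n).  The grade of each ideal is at most 3
   because a regular sequence f_1, f_2, f_3 in (x, y, z) has a nonzero socle element (the
   determinant of the coefficients of the f_i on x, y, z), so no f_4 can follow.

   For the Hilbert function, the Euler characteristic of the degree j strand of the
   Koszul complex of R/J gives h(j) - 3 h(j-1) + 3 h(j-2) - h(j-3) as the alternating sum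
   of the Betti numbers, which determines h.  The number of standard monomials of J'
   satisfies the same recursion: multiply its generating polynomial by (1 - t)^3. *)
From HB Require Import structures.
Require Import Defs.
From mathcomp Require Import all_boot all_algebra.
From mathcomp Require Import zify ring.
From Stdlib Require Import Classical FunctionalExtensionality PropExtensionality.

Set Implicit Arguments.
Unset Strict Implicit.
Unset Printing Implicit Defensive.

Import GRing.Theory.
Local Open Scope ring_scope.

(** * Ideals and monomial ideals *)

Section Ideals.
Variable k : fieldType.
Local Notation R := {mpoly k[3]}.
Implicit Types (f g p : R) (I : R -> Prop) (fs : seq R).

Lemma is_ideal_sum I (T : Type) (r : seq T) (P : pred T) (F : T -> R) :
  is_ideal I -> (forall i, P i -> I (F i)) -> I (\sum_(i <- r | P i) F i).
Proof. by case=> I0 [ID _] IF; apply: (big_ind I). Qed.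

Lemma is_idealZ I (c : k) f : is_ideal I -> I f -> I (c *: f).
Proof. by case=> _ [_ IM] If; rewrite -mul_mpolyC; apply: IM. Qed.

Lemma is_idealN I f : is_ideal I -> I f -> I (- f).
Proof. by move=> iI If; rewrite -scaleN1r; apply: is_idealZ. Qed.

Lemma gen_ideal fs : is_ideal (gen fs).
Proof.
split; first by exists (fun _ => 0); rewrite big1 // => i _; rewrite mul0r.
split=> [f g [c ->] [d ->]|f g [c ->]].
  exists (fun i => c i + d i).
  by rewrite -big_split; apply: eq_bigr => i _; rewrite mulrDl.
exists (fun i => f * c i); rewrite big_distrr /=.
by apply: eq_bigr => i _; rewrite mulrA.
Qed.

Lemma gen_mem fs f : f \in fs -> gen fs f.
Proof.
move=> ffs; have lt_i : (index f fs < size fs)%N by rewrite index_mem.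
exists (fun i => (i == Ordinal lt_i)%:R).
rewrite (bigD1 (Ordinal lt_i)) //= eqxx mul1r nth_index // big1 ?addr0 //.
by move=> i /negPf->; rewrite mul0r.
Qed.

Lemma gen_min fs I f :
  is_ideal I -> (forall g, g \in fs -> I g) -> gen fs f -> I f.
Proof.
move=> iI Ifs [c ->]; apply: is_ideal_sum => // i _.
by case: iI => _ [_]; apply; apply: Ifs; rewrite mem_nth.
Qed.

Lemma gen0P f : gen [::] f <-> f = 0.
Proof.
split=> [[c ->]|->]; first by rewrite big_ord0.
by case: (gen_ideal [::]).
Qed.

Lemma gen1P f1 f : gen [:: f1] f <-> exists p, f = p * f1.
Proof.
split=> [[c ->]|[p ->]]; first by exists (c ord0); rewrite big_ord1.
by exists (fun _ => p); rewrite big_ord1.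
Qed.

Lemma gen2P f1 f2 f : gen [:: f1; f2] f <-> exists p q, f = p * f1 + q * f2.
Proof.
split=> [[c ->]|[p [q ->]]].
  by exists (c ord0), (c ord_max); rewrite big_ord_recl big_ord1 /=;
     congr (_ + c _ * _); apply: val_inj.
by exists (fun i => if val i == 0%N then p else q); rewrite big_ord_recl big_ord1.
Qed.

Lemma gen3P f1 f2 f3 f :
  gen [:: f1; f2; f3] f <-> exists p q r, f = p * f1 + q * f2 + r * f3.
Proof.
split=> [[c ->]|[p [q [r ->]]]].
  exists (c ord0), (c (inord 1)), (c ord_max).
  rewrite !big_ord_recl big_ord0 addr0 addrA /=.
  by congr (_ + c _ * _ + c _ * _); apply: val_inj; rewrite /= ?inordK.
exists (fun i => nth 0 [:: p; q; r] i).
by rewrite !big_ord_recl big_ord0 addr0 addrA.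
Qed.

End Ideals.

(* Writing f_i = a_i x + b_i y + c_i z, the determinant of the coefficients
   spans the top Koszul homology of A/(f_1, f_2, f_3); it is nonzero because the
   classes of 1, a_1, a_1 /\ a_2, a_1 /\ a_2 /\ a_3 are successive liftings
   through the connecting maps of the regular sequence. *)
Lemma det_notin_regular (A : comNzRingType) (x y z : A)
    (a1 b1 c1 a2 b2 c2 a3 b3 c3 f1 f2 f3 : A) :
  f1 = a1 * x + b1 * y + c1 * z ->
  f2 = a2 * x + b2 * y + c2 * z ->
  f3 = a3 * x + b3 * y + c3 * z ->
  (forall u v w, 1 <> u * x + v * y + w * z) ->
  (forall g, f1 * g = 0 -> g = 0) ->
  (forall g p, f2 * g = p * f1 -> exists p', g = p' * f1) ->
  (forall g p q, f3 * g = p * f1 + q * f2 -> exists p' q', g = p' * f1 + q' * f2) ->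
  forall p q r,
    a1 * (b2 * c3 - c2 * b3) - b1 * (a2 * c3 - c2 * a3) + c1 * (a2 * b3 - b2 * a3)
      <> p * f1 + q * f2 + r * f3.
Proof.
move=> E1 E2 E3 H0 H1 H2 H3 p q r.
set w := (X in X <> _) => E.

(* Cramer's rule writes [x * w], [y * w] and [z * w] through the [f_i] and the 2 x 2 minors.
   Inserting the assumed expression of [w] and cancelling [f3] modulo [f1, f2] puts each minor of
   the first two rows, corrected by a multiple of [r], in the ideal of [f1, f2]. *)
have [u1 [v1 U1]] : exists u v, b1 * c2 - c1 * b2 - r * x = u * f1 + v * f2.
  apply: (H3 _ (x * p - (b2 * c3 - c2 * b3)) (x * q + (b1 * c3 - c1 * b3))).
  have -> : f3 * (b1 * c2 - c1 * b2 - r * x)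
      = x * w - f1 * (b2 * c3 - c2 * b3) + f2 * (b1 * c3 - c1 * b3) - f3 * r * x.
    by rewrite /w E1 E2 E3; ring.
  by rewrite E; ring.
have [u2 [v2 U2]] : exists u v, a1 * c2 - c1 * a2 + r * y = u * f1 + v * f2.
  apply: (H3 _ (- y * p - (a2 * c3 - c2 * a3)) (- y * q + (a1 * c3 - c1 * a3))).
  have -> : f3 * (a1 * c2 - c1 * a2 + r * y)
      = - y * w - f1 * (a2 * c3 - c2 * a3) + f2 * (a1 * c3 - c1 * a3) + f3 * r * y.
    by rewrite /w E1 E2 E3; ring.
  by rewrite E; ring.
have [u3 [v3 U3]] : exists u v, a1 * b2 - b1 * a2 - r * z = u * f1 + v * f2.
  apply: (H3 _ (z * p - (a2 * b3 - b2 * a3)) (z * q + (a1 * b3 - b1 * a3))).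
  have -> : f3 * (a1 * b2 - b1 * a2 - r * z)
      = z * w - f1 * (a2 * b3 - b2 * a3) + f2 * (a1 * b3 - b1 * a3) - f3 * r * z.
    by rewrite /w E1 E2 E3; ring.
  by rewrite E; ring.
(* One level down: [f2 * a1 - f1 * a2] is a combination of the minors with coefficients [y] and [z],
   in which the corrections by [r] cancel. Now [f2] is cancelled modulo [f1]. *)
have [s1 S1] : exists s, a1 - y * v3 - z * v2 = s * f1.
  apply: (H2 _ (a2 + y * u3 + z * u2)).
  have -> : f2 * (a1 - y * v3 - z * v2)
      = f1 * a2 + y * (a1 * b2 - b1 * a2 - r * z) + z * (a1 * c2 - c1 * a2 + r * y)
        - f2 * (y * v3 + z * v2) by rewrite E1 E2; ring.
  by rewrite U2 U3; ring.
have [s2 S2] : exists s, b1 + x * v3 - z * v1 = s * f1.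
  apply: (H2 _ (b2 - x * u3 + z * u1)).
  have -> : f2 * (b1 + x * v3 - z * v1)
      = f1 * b2 - x * (a1 * b2 - b1 * a2 - r * z) + z * (b1 * c2 - c1 * b2 - r * x)
        + f2 * (x * v3 - z * v1) by rewrite E1 E2; ring.
  by rewrite U1 U3; ring.
have [s3 S3] : exists s, c1 + x * v2 + y * v1 = s * f1.
  apply: (H2 _ (c2 - x * u2 - y * u1)).
  have -> : f2 * (c1 + x * v2 + y * v1)
      = f1 * c2 - x * (a1 * c2 - c1 * a2 + r * y) - y * (b1 * c2 - c1 * b2 - r * x)
        + f2 * (x * v2 + y * v1) by rewrite E1 E2; ring.
  by rewrite U1 U2; ring.
(* Last level: the corrections by [v1, v2, v3] cancel in [f1 = a1 * x + b1 * y + c1 * z], and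
   cancelling [f1] itself leaves 1 in the ideal of [x, y, z]. *)
apply: (H0 s1 s2 s3); apply/eqP; rewrite -subr_eq0; apply/eqP; apply: H1.
have -> : f1 * (1 - (s1 * x + s2 * y + s3 * z))
    = f1 - (s1 * f1 * x + s2 * f1 * y + s3 * f1 * z) by ring.
by rewrite -S1 -S2 -S3 E1; ring.
Qed.

(** * Monomial ideals: membership, colon ideals, grade and links *)

Section MonomialIdeals.
Variable k : fieldType.
Local Notation R := {mpoly k[3]}.
Implicit Types (f g p : R) (I : R -> Prop) (fs : seq R).
Implicit Types (m : 'X_{1..3}) (t : nat * nat * nat) (ts : seq (nat * nat * nat)).

(** Exponents are handled as triples of naturals, so that divisibility of monomials becomes linear
    arithmetic within reach of [lia]. *)
Definition expo t : 'X_{1..3} :=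
  (U_(ord0) *+ t.1.1 + U_(inord 1) *+ t.1.2 + U_(ord_max) *+ t.2)%MM.

Definition mono t : R := 'X_[expo t].

Lemma monoE t : mono t = vx k ^+ t.1.1 * vy k ^+ t.1.2 * vz k ^+ t.2.
Proof. by rewrite /mono /expo !mpolyXD -!mpolyXn. Qed.

Lemma expoE t : (expo t ord0 = t.1.1) * (expo t (inord 1) = t.1.2) *
  (expo t ord_max = t.2).
Proof.
by split; first split; rewrite /expo !mnmDE !mulmnE !mnm1E -!val_eqE /= ?inordK //=;
   rewrite ?mul0n ?mul1n ?addn0 ?add0n.
Qed.

Lemma I3P (P : 'I_3 -> Prop) : P ord0 -> P (inord 1) -> P ord_max -> forall i, P i.
Proof.
move=> P0 P1 P2 [[|[|[|i]]] // lti].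
- by rewrite (_ : Ordinal lti = ord0) //; apply: val_inj.
- by rewrite (_ : Ordinal lti = inord 1) //; apply: val_inj; rewrite /= inordK.
- by rewrite (_ : Ordinal lti = ord_max) //; apply: val_inj.
Qed.

Lemma expoK m : expo (m ord0, m (inord 1), m ord_max) = m.
Proof. by apply/mnmP; apply: I3P; rewrite expoE. Qed.

Lemma mdeg_expo t : mdeg (expo t) = (t.1.1 + t.1.2 + t.2)%N.
Proof. by rewrite /expo !mdegD !mdegMn !mdeg1 !mul1n. Qed.

Lemma expoD t t' :
  (expo t + expo t')%MM = expo (t.1.1 + t'.1.1, t.1.2 + t'.1.2, t.2 + t'.2)%N.
Proof. by apply/mnmP; apply: I3P; rewrite mnmDE !expoE. Qed.

Lemma monoD t t' :
  mono t * mono t' = mono (t.1.1 + t'.1.1, t.1.2 + t'.1.2, t.2 + t'.2)%N.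
Proof. by rewrite /mono -mpolyXD expoD. Qed.

Definition divt t t' := [&& t.1.1 <= t'.1.1, t.1.2 <= t'.1.2 & t.2 <= t'.2]%N.

Definition covers ts t := has (divt^~ t) ts.

(** Membership is read off the support of [f]; [genE_monoI] identifies this with the ideal generated
    by the monomials of [ts]. *)
Definition monoI ts : R -> Prop :=
  fun f => forall t, f@_(expo t) != 0 -> covers ts t.

Lemma divt_trans t1 t2 t3 : divt t1 t2 -> divt t2 t3 -> divt t1 t3.
Proof. rewrite /divt; lia. Qed.

Lemma covers_up ts t t' : divt t t' -> covers ts t -> covers ts t'.
Proof.
move=> tt' /hasP[s sts st]; apply/hasP; exists s => //.
exact: divt_trans tt'.
Qed.

Lemma monoI_supp ts f m :
  monoI ts f -> m \in msupp f -> covers ts (m ord0, m (inord 1), m ord_max).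
Proof. by move=> If mf; apply: If; rewrite expoK -mcoeff_msupp. Qed.

Lemma expo_inj : injective expo.
Proof.
move=> [[a b] c] [[a' b'] c'] /mnmP E.
by move: (E ord0) (E (inord 1)) (E ord_max); rewrite !expoE /= => -> -> ->.
Qed.

Lemma monoI_mono ts t : monoI ts (mono t) <-> covers ts t.
Proof.
split=> [/(_ t)|cov t']; rewrite /mono mcoeffX.
  by rewrite eqxx oner_eq0; apply.
by have [/expo_inj <- //|_] := eqVneq (expo t) (expo t'); rewrite mulr0n eqxx.
Qed.

Lemma monoI_ideal ts : is_ideal (monoI ts).
Proof.
split; first by move=> t; rewrite mcoeff0 eqxx.
split=> [f g If Ig t|f g Ig t].
  rewrite mcoeffD; have [->|/If //] := eqVneq f@_(expo t) 0.
  by rewrite add0r; apply: Ig.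
rewrite -mcoeff_msupp => /msuppM_le /allpairsP[[m1 m2] /= [_ m2g E]].
apply: covers_up (monoI_supp Ig m2g); rewrite /divt /=.
by move/mnmP: E => E; move: (E ord0) (E (inord 1)) (E ord_max);
   rewrite !expoE !mnmDE => -> -> ->; rewrite !leq_addl.
Qed.

Lemma mcoeff_hcomp d f m : (hcomp d f)@_m = if mdeg m == d then f@_m else 0.
Proof.
rewrite /hcomp raddf_sum /=.
have [mf|mf] := boolP (m \in msupp f); last first.
  rewrite (memN_msupp_eq0 mf) if_same big1_seq // => m' /andP[_ m'f].
  rewrite mcoeffZ mcoeffX; case: eqP => [E|]; last by rewrite mulr0.
  by rewrite -E m'f in mf.
have [dm|dm] := ifPn.
  rewrite -big_filter (bigD1_seq m) /= ?mem_filter ?dm ?filter_uniq ?msupp_uniq //.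
  rewrite mcoeffZ mcoeffX eqxx mulr1 big1_seq ?addr0 // => m' /andP[/negPf m'm _].
  by rewrite mcoeffZ mcoeffX m'm mulr0.
rewrite big1 // => m' dm'; rewrite mcoeffZ mcoeffX.
by case: eqP => [E|]; [rewrite -E dm' in dm | rewrite mulr0].
Qed.

Lemma monoI_homog ts : homog_ideal (monoI ts).
Proof.
split=> [|f d If t]; first exact: monoI_ideal.
by rewrite mcoeff_hcomp; case: ifP => _; [apply: If | rewrite eqxx].
Qed.

Lemma genE_monoI ts f : gen (map mono ts) f <-> monoI ts f.
Proof.
split.
  apply: gen_min; first exact: monoI_ideal.
  move=> _ /mapP[t tts ->]; apply/monoI_mono/hasP; exists t => //.
  by rewrite /divt !leqnn.
move=> If; rewrite (mpolyE f) big_seq.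
apply: is_ideal_sum; first exact: gen_ideal.
move=> m /(monoI_supp If) /hasP[t tts /and3P[/= l0 l1 l2]].
apply: is_idealZ; first exact: gen_ideal.
have -> : 'X_[m] = mono (m ord0 - t.1.1, m (inord 1) - t.1.2, m ord_max - t.2)%N * mono t.
  by rewrite monoD /= !subnK // /mono expoK.
case: (gen_ideal (map mono ts)) => _ [_]; apply.
by apply: gen_mem; apply: map_f.
Qed.

(** Multiplication by a monomial translates the support, so no cancellation can occur. *)
Lemma monoI_mulmono ts f t :
  monoI ts (f * mono t) <->
  forall s, f@_(expo s) != 0 ->
    covers ts (s.1.1 + t.1.1, s.1.2 + t.1.2, s.2 + t.2)%N.
Proof.
split=> [If s fs|H s].
  by apply: If; rewrite -expoD addmC mcoeffMX.
rewrite -mcoeff_msupp => /msuppM_le /allpairsP[[m1 m2] /= [m1f m2g E]].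
move: m2g; rewrite msuppX inE => /eqP Em2.
have := H (m1 ord0, m1 (inord 1), m1 ord_max); rewrite expoK -mcoeff_msupp m1f.
move=> /(_ isT); congr covers; apply: expo_inj.
by rewrite E Em2 -[X in (X + _)%MM]expoK expoD.
Qed.

Lemma colon_monoI ts ts' f :
  colon (monoI ts) (monoI ts') f <->
  forall s t, f@_(expo s) != 0 -> covers ts' t ->
    covers ts (s.1.1 + t.1.1, s.1.2 + t.1.2, s.2 + t.2)%N.
Proof.
split=> [H s t fs ct|H h Ih].
  by have /monoI_mulmono := H _ (iffRL (monoI_mono ts' t) ct); apply.
rewrite (mpolyE h) mulr_sumr big_seq.
apply: (is_ideal_sum _ (monoI_ideal ts)) => m.
move=> /(monoI_supp Ih) cm; rewrite -scalerAr.
apply: (is_idealZ _ (monoI_ideal ts)).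
by rewrite -(expoK m); apply/monoI_mulmono => s fs; apply: H.
Qed.

Definition box a b c := [:: (a, 0, 0); (0, b, 0); (0, 0, c)]%N.

(** For a monomial s inside the box, the t with s + t still inside are exactly the divisors of the
    corner (a-1, b-1, c-1) minus s. Hence s lies in the colon ideal iff that one reflected monomial
    is outside the ideal of [ts]. *)
Lemma colon_box a b c ts ts' :
  (forall u v w, covers ts' (u, v, w) =
     covers (box a b c) (u, v, w) || ~~ covers ts (a.-1 - u, b.-1 - v, c.-1 - w)%N) ->
  eqI (monoI ts') (colon (gen (map mono (box a b c))) (monoI ts)).
Proof.
move=> E f.
suff -> : colon (gen (map mono (box a b c))) (monoI ts) f
    <-> colon (monoI (box a b c)) (monoI ts) f.
  rewrite colon_monoI; split=> [If [[u v] w] [[u' v'] w'] fs ct|H [[u v] w] fs].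
    move/If: fs; rewrite E => /orP[|].
      by apply: covers_up; rewrite /divt /=; lia.
    apply: contraNT => nb; apply: covers_up ct; move: nb.
    by rewrite /covers /divt /=; lia.
  (* Testing against the reflected monomial: the product is the corner of the box, which the
     complete intersection does not contain. *)
  rewrite E; case: (boolP (covers (box a b c) (u, v, w))) => //= nb.
  apply/negP => ct; have := H _ _ fs ct; move: nb.
  by rewrite /covers /divt /=; lia.
by split=> H h /H; rewrite genE_monoI.
Qed.

Lemma regular_box a b c :
  (0 < a)%N -> (0 < b)%N -> (0 < c)%N -> regular (map mono (box a b c)).
Proof.
move=> a0 b0 c0; split.
  have -> : 1 = mono (0, 0, 0)%N by rewrite monoE /= !expr0 !mulr1.
  by rewrite genE_monoI monoI_mono /covers /divt /=; lia.
move=> i lti g; rewrite -map_take !genE_monoI mulrC (nth_map (0,0,0)%N) //.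
rewrite monoI_mulmono => H [[u v] w] gs; move: (H _ gs) => /=.
case: i lti {H} => [|[|[|i]]] //= _; rewrite /covers /divt /=; lia.
Qed.

(** Without constant term, [f] lies in the monomial ideal of [box 1 1 1], which is (x, y, z). *)
Lemma mcoeff0_lincomb f : (f@_0 = 0) ->
  exists a b c, f = a * vx k + b * vy k + c * vz k.
Proof.
move=> f0; apply/gen3P.
suff /genE_monoI : monoI (box 1 1 1) f.
  by rewrite /= !monoE /= !expr0 !expr1 !mul1r !mulr1.
move=> [[u v] w]; apply: contraNT; rewrite /covers /divt /= => nc.
have -> : u = 0%N by lia. have -> : v = 0%N by lia. have -> : w = 0%N by lia.
by rewrite /expo /= !mulm0n !addm0 f0.
Qed.

Lemma mcoeff0_maximal u v w : (u * vx k + v * vy k + w * vz k)@_0 = 0.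
Proof.
by rewrite !mcoeffD !rmorphM /= !mcoeffX !mnm1_eq0 !mulr0 !addr0.
Qed.

Lemma regular_size_le3 fs :
  regular fs -> (forall f, f \in fs -> f@_0 = 0) -> (size fs <= 3)%N.
Proof.
case: fs => [|f1 [|f2 [|f3 [|f4 fs]]]] // [_ reg] fs0; exfalso.
have := reg 0%N isT; have := reg 1%N isT; have := reg 2 isT; have := reg 3 isT.
rewrite /= ?take0 => r4 r3 r2 r1.
have mem0 i : (i < 4)%N -> ([:: f1, f2, f3, f4 & fs]`_i)@_0 = 0.
  by move=> lti; apply: fs0; apply: mem_nth; apply: leq_trans lti _.
have [a1 [b1 [c1 E1]]] := mcoeff0_lincomb (mem0 0%N isT).
have [a2 [b2 [c2 E2]]] := mcoeff0_lincomb (mem0 1%N isT).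
have [a3 [b3 [c3 E3]]] := mcoeff0_lincomb (mem0 2%N isT).
have [a4 [b4 [c4 E4]]] := mcoeff0_lincomb (mem0 3%N isT).
rewrite /= in E1 E2 E3 E4.
pose w := a1 * (b2 * c3 - c2 * b3) - b1 * (a2 * c3 - c2 * a3)
  + c1 * (a2 * b3 - b2 * a3).
have : gen [:: f1; f2; f3] w.
  apply: r4; apply/gen3P.
  (* The witnesses add the Cramer expansions of x w, y w and z w, weighted by the coefficients [a4],
     [b4], [c4] of [f4]. Thus [f4 * w] lies in the ideal of [f1, f2, f3], and regularity of [f4]
     puts [w] there. *)
  exists (a4 * (b2 * c3 - c2 * b3) - b4 * (a2 * c3 - c2 * a3) + c4 * (a2 * b3 - b2 * a3)).
  exists (- a4 * (b1 * c3 - c1 * b3) + b4 * (a1 * c3 - c1 * a3) - c4 * (a1 * b3 - b1 * a3)).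
  exists (a4 * (b1 * c2 - c1 * b2) - b4 * (a1 * c2 - c1 * a2) + c4 * (a1 * b2 - b1 * a2)).
  by rewrite /w E4 E3 E2 E1; ring.
move=> /gen3P[p [q [r]]].
apply: (det_notin_regular E1 E2 E3).
- move=> u v t /(congr1 (mcoeff 0%MM)).
  by rewrite mcoeff0_maximal mcoeff1 eqxx => /eqP; rewrite oner_eq0.
- by move=> g /gen0P /r1 /gen0P.
- by move=> g s E; apply/gen1P/r2/gen1P; exists s.
- by move=> g s s' E; apply/gen2P/r3/gen2P; exists s, s'.
Qed.

(** The three pure powers form a regular sequence inside the ideal. As 1 is not covered, every
    member has zero constant term, and [regular_size_le3] bounds all other regular sequences. *)
Lemma grade_monoI a b c ts :
  covers ts (a, 0, 0)%N -> covers ts (0, b, 0)%N -> covers ts (0, 0, c)%N ->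
  ~~ covers ts (0, 0, 0)%N -> grade (monoI ts) 3.
Proof.
move=> ca cb cc c0.
have one : mono (0, 0, 0)%N = 1 by rewrite monoE /= !expr0 !mulr1.
split; first by rewrite -one monoI_mono; apply/negP.
split.
  exists (map mono (box a b c)); split=> //; split.
    apply: regular_box; rewrite lt0n; apply: contraNneq c0 => E.
    - by rewrite E in ca.
    - by rewrite E in cb.
    - by rewrite E in cc.
  by move=> f; rewrite !inE => /or3P[] /eqP->; apply/monoI_mono.
move=> fs /regular_size_le3 H Ifs; apply: H => f /Ifs /(_ (0, 0, 0)%N).
rewrite (_ : expo _ = 0%MM) ?(negPf c0).
  by case: eqVneq => // _ /(_ isT).
by rewrite /expo /= !mulm0n !addm0.
Qed.

Lemma hci_box a b c :
  (0 < a)%N -> (a <= b)%N -> (b <= c)%N -> hci (map mono (box a b c)) 3.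
Proof.
move=> a0 ab bc; split=> //; split; first by apply: regular_box => //; lia.
have pd t : pdeg (mono t) = (t.1.1 + t.1.2 + t.2)%N.
  by rewrite /pdeg /mono msizeX mdeg_expo.
split; last by rewrite /= !pd /= !addn0 !add0n ab bc.
move=> f; rewrite !inE => /or3P[] /eqP->;
  by rewrite /mono qualifE /= /ishomog_pred /= -/(msize _) msizeX dhomogX.
Qed.

Lemma ci_type_box a b c : ci_type (map mono (box a b c)) = [:: a; b; c].
Proof.
by rewrite /ci_type /= /pdeg /mono !msizeX !mdeg_expo /= !addn0 !add0n.
Qed.

(** Reduces a direct link to two boolean identities in u, v, w, which [lia] decides for explicit
    generators. *)
Lemma linked_box a b c ts ts' :
  (0 < a)%N -> (a <= b)%N -> (b <= c)%N ->
  ~~ covers ts (0, 0, 0)%N -> ~~ covers ts' (0, 0, 0)%N ->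
  (forall u v w, covers ts (u, v, w) =
     covers (box a b c) (u, v, w) || ~~ covers ts' (a.-1 - u, b.-1 - v, c.-1 - w)%N) ->
  (forall u v w, covers ts' (u, v, w) =
     covers (box a b c) (u, v, w) || ~~ covers ts (a.-1 - u, b.-1 - v, c.-1 - w)%N) ->
  linked (monoI ts) (monoI ts') (map mono (box a b c)) 3.
Proof.
move=> a0 ab bc n0 n0' E E'.
split; first exact: monoI_homog.
split; first exact: monoI_homog.
split; first by apply: (@grade_monoI a b c) => //; rewrite ?E; apply/orP; left;
  rewrite /covers /divt /=; lia.
split; first by apply: (@grade_monoI a b c) => //; rewrite ?E'; apply/orP; left;
  rewrite /covers /divt /=; lia.
split; first exact: hci_box.
by split; apply: colon_box.
Qed.

End MonomialIdeals.

(** * The chain of links from J' to a complete intersection *)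

Definition Jprime_expo n : seq (nat * nat * nat) :=
  [:: (2, 0, 0); (0, 2 * n + 1, 0); (0, 0, 2 * n + 4); (0, n, 1); (1, n - 1, 1);
      (1, 1, n + 1)]%N.

Lemma Jprime_gensE (k : fieldType) n : Jprime_gens k n = map (@mono k) (Jprime_expo n).
Proof. by rewrite /= !monoE /= !expr0 !expr1 !mulr1 !mul1r. Qed.

(** Each ideal is the reflected complement of its predecessor in the box [link_ci n i]. The default
    value of [nth] is the complete intersection reached at index 4. *)
Definition link_expo n i : seq (nat * nat * nat) :=
  nth [:: (1, 0, 0); (0, n - 2, 0); (0, 0, n)]%N
   [:: Jprime_expo n;
    [:: (2, 0, 0); (1, n + 1, 0); (0, 2 * n, 0); (0, n + 2, n + 3); (0, 0, 2 * n + 3)];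
    [:: (2, 0, 0); (1, n - 2, 0); (1, 0, n); (0, n - 1, 0); (0, 0, 2 * n + 3)];
    [:: (1, 0, 0); (0, n - 1, 0); (0, 1, n + 3); (0, 0, 2 * n + 3)]]%N i.

Definition link_ci n i : seq (nat * nat * nat) :=
  nth [::] [:: box 2 (2 * n + 1) (2 * n + 4); box 2 (2 * n) (2 * n + 3);
               box 2 (n - 1) (2 * n + 3); box 1 (n - 1) (2 * n + 3)] i.

Lemma Jprime_links (k : fieldType) n : (4 <= n)%N ->
  exists (g s : nat) (Is : nat -> {mpoly k[3]} -> Prop) (Cs : nat -> seq {mpoly k[3]}),
    eqI (Is 0%N) (gen (Jprime_gens k n)) /\
    (forall t, (t < s)%N -> linked (Is t) (Is t.+1) (Cs t) g) /\
    (exists fs, hci fs g /\ eqI (Is s) (gen fs)) /\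
    (forall t, (t.+1 < s)%N -> forall l, (l < g)%N ->
        (nth 0%N (ci_type (Cs t.+1)) l <= nth 0%N (ci_type (Cs t)) l)%N).
Proof.
move=> n4; exists 3, 4, (fun i => monoI (link_expo n i)).
exists (fun i => map (@mono k) (link_ci n i)).
split; first by move=> f; rewrite Jprime_gensE genE_monoI.
split.
  move=> [|[|[|[|t]]]] // _; apply: linked_box; rewrite ?/covers ?/divt /=; try lia.
split.
  exists (map (@mono k) (box 1 (n - 2) n)); split; first by apply: hci_box; lia.
  by move=> f; rewrite genE_monoI.
move=> [|[|[|t]]] // _ [|[|[|l]]] // _; rewrite !ci_type_box /=; lia.
Qed.

(** * Dimension of subquotients *)

Section Dimension.
Variable k : fieldType.

Definition subsp (V : lmodType k) (A : V -> Prop) : Prop :=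
  A 0 /\ forall c u v, A u -> A v -> A (c *: u + v).

Definition pred_incl (V : Type) (B A : V -> Prop) : Prop := forall v, B v -> A v.

(** The spanning form of [dim_mod]: unlike maximality among independent families, it transports
    directly along maps and extensions. *)
Definition basis_mod (V : lmodType k) (A B : V -> Prop) (m : nat) : Prop :=
  exists s : 'I_m -> V, rel_indep A B s /\
    forall a, A a -> exists c : 'I_m -> k, B (a - \sum_(i < m) c i *: s i).

Section OneSpace.
Variable V : lmodType k.
Implicit Types (A B C : V -> Prop).

Lemma subspZ A c v : subsp A -> A v -> A (c *: v).
Proof. by case=> A0 AZ Av; rewrite -[_ *: _]addr0; apply: AZ. Qed.

Lemma subspD A u v : subsp A -> A u -> A v -> A (u + v).
Proof. by case=> A0 AZ Au Av; rewrite -[u]scale1r; apply: AZ. Qed.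

Lemma subspB A u v : subsp A -> A u -> A v -> A (u - v).
Proof. by move=> sA Au Av; apply: subspD => //; rewrite -scaleN1r; apply: subspZ. Qed.

Lemma subsp_sum A (T : Type) (r : seq T) (P : pred T) (F : T -> V) :
  subsp A -> (forall i, P i -> A (F i)) -> A (\sum_(i <- r | P i) F i).
Proof. by move=> sA; apply: big_ind; [case: sA | move=> u v; apply: subspD]. Qed.

Lemma subsp_comb A n (c : 'I_n -> k) (s : 'I_n -> V) :
  subsp A -> (forall i, A (s i)) -> A (\sum_(i < n) c i *: s i).
Proof. by move=> sA As; apply: subsp_sum => // i _; apply: subspZ. Qed.

(** A vector outside the span of a maximal independent family could be adjoined to it, giving m+1
    independent vectors. *)
Lemma dim_mod_basis A B m :
  subsp A -> subsp B -> dim_mod A B m -> basis_mod A B m.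
Proof.
move=> sA sB [[s [As inds]] maxs]; exists s; split=> // a Aa.
apply: NNPP => nspan.
suff : rel_indep A B (fun i : 'I_m.+1 => oapp s a (unlift ord0 i)).
  by move/maxs; rewrite ltnn.
split=> [i|c]; first by case: unliftP => [j _|_] /=; [apply: As | apply: Aa].
rewrite big_ord_recl unlift_none /=.
under eq_bigr do rewrite liftK /=.
move=> Bc; have c0 : c ord0 = 0.
  apply/eqP/negPn/negP => c0; apply: nspan.
  (* A nonzero coefficient of [a] in the relation allows solving for [a] modulo [B]. *)
  exists (fun i => - ((c ord0)^-1 * c (lift ord0 i))).
  rewrite (_ : a - _ = (c ord0)^-1 *: (c ord0 *: a + \sum_(i < m) c (lift ord0 i) *: s i)).
    exact: subspZ.
  rewrite scalerDr scalerA mulVf // scale1r; congr (_ + _).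
  by rewrite -sumrN scaler_sumr; apply: eq_bigr => i _; rewrite scaleNr opprK scalerA.
move=> i; case: (unliftP ord0 i) => [j ->|->] //.
by apply: (inds (fun j => c (lift ord0 j))); move: Bc; rewrite c0 scale0r add0r.
Qed.

(** The coordinates of an independent family over the basis form an n x m matrix with independent
    rows, so n <= m. *)
Lemma basis_dim_mod A B m : subsp B -> basis_mod A B m -> dim_mod A B m.
Proof.
move=> sB [s [[As inds] span]]; split; first by exists s.
move=> n t [At indt].
have /fin_all_exists [c cP] := fun i => span (t i) (At i).
pose M := \matrix_(i < n, j < m) c i j.
suff : row_free M by move/eqP <-; apply: rank_leq_col.
apply: inj_row_free => v vM; apply/rowP => i; rewrite mxE.
apply: (indt (fun i => v 0 i)).
rewrite (_ : \sum_(i < n) _ = \sum_(i < n) v 0 i *: (t i - \sum_(j < m) c i j *: s j)).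
  by apply: subsp_comb.
under [RHS]eq_bigr do rewrite scalerBr scaler_sumr.
rewrite sumrB exchange_big /= [X in _ - X]big1 ?subr0 // => j _.
under eq_bigr do rewrite scalerA.
rewrite -scaler_suml; move/rowP/(_ j): vM; rewrite !mxE => E.
by rewrite (_ : \sum_(i < n) _ = 0) ?scale0r // -[RHS]E; apply: eq_bigr => l _; rewrite mxE.
Qed.

Lemma dim_mod_unique A B m m' : dim_mod A B m -> dim_mod A B m' -> m = m'.
Proof.
move=> [[s Hs] ms] [[s' Hs'] ms']; apply/eqP; rewrite eqn_leq.
by rewrite (ms' _ _ Hs) (ms _ _ Hs').
Qed.

(** Comparing [B] and [B'] only on [A] lets [hilb], whose denominator is the whole ideal, be
    rewritten with the part of the ideal in one degree. *)
Lemma dim_mod_ext A B A' B' m :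
  subsp A -> (forall v, A v <-> A' v) -> (forall v, A v -> (B v <-> B' v)) ->
  dim_mod A B m -> dim_mod A' B' m.
Proof.
move=> sA EA EB [[s [As inds]] maxs].
have E n (t : 'I_n -> V) : rel_indep A B t <-> rel_indep A' B' t.
  split=> [[At indt]|[At indt]]; split=> [i|c Bc]; try by apply/EA.
    by apply: indt; apply/EB => //; apply: subsp_comb.
  by apply: indt; apply/EB => //; apply: subsp_comb => // i; apply/EA.
split; first by exists s; apply/E.
by move=> n t /E; apply: maxs.
Qed.

Lemma dim_mod_exists A B m :
  (forall n (s : 'I_n -> V), rel_indep A B s -> (n <= m)%N) ->
  exists p, dim_mod A B p.
Proof.
elim: m => [|m IH] bound.
  exists 0%N; split=> //; exists (fun _ => 0); split; first by case.
  by move=> c _ [].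
case: (classic (exists s : 'I_m.+1 -> V, rel_indep A B s)) => [[s Hs]|no].
  by exists m.+1; split=> //; exists s.
apply: IH => n s Hs; have := bound n s Hs; rewrite leq_eqVlt => /orP[/eqP E|//].
by case: no; move: s Hs; rewrite E => s Hs; exists s.
Qed.

(** Lifts of a basis of A/C followed by a basis of C/B form a basis of A/B. *)
Lemma dim_modD A B C p q :
  subsp A -> subsp B -> subsp C -> pred_incl B C -> pred_incl C A ->
  dim_mod A C p -> dim_mod C B q -> dim_mod A B (p + q).
Proof.
move=> sA sB sC BC CA /(dim_mod_basis sA sC)[s [[As inds] spans]].
move=> /(dim_mod_basis sC sB)[t [[Ct indt] spant]].
apply: basis_dim_mod => //.
exists (fun i => match split i with inl i => s i | inr j => t j end).
have E (c : 'I_(p + q) -> k) :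
    \sum_(i < p + q) c i *: match split i with inl i => s i | inr j => t j end
    = \sum_(i < p) c (lshift q i) *: s i + \sum_(j < q) c (rshift p j) *: t j.
  rewrite big_split_ord /=; congr (_ + _); apply: eq_bigr => i _.
    by rewrite (unsplitK (inl i)).
  by rewrite (unsplitK (inr i)).
split; first split.
- by move=> i; case: split => j; [apply: As | apply/CA/Ct].
- move=> c; rewrite E => Bc.
  have c1 : forall i, c (lshift q i) = 0.
    apply: (inds (fun i => c (lshift q i))).
    rewrite -[X in C X](addrK (\sum_(j < q) c (rshift p j) *: t j)).
    by apply: subspB => //; [apply: BC | apply: subsp_comb].
  have c2 : forall i, c (rshift p i) = 0.
    apply: (indt (fun i => c (rshift p i))); move: Bc.
    by rewrite big1 ?add0r // => i _; rewrite c1 scale0r.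
  by move=> i; rewrite -(splitK i); case: split => j /=.
move=> a Aa; have [c Cc] := spans a Aa; have [d Bd] := spant _ Cc.
exists (fun i => match split i with inl i => c i | inr j => d j end).
rewrite E; congr B: Bd; rewrite opprD addrA; congr (_ - _ - _); apply: eq_bigr => i _.
  by rewrite (unsplitK (inl i)).
by rewrite (unsplitK (inr i)).
Qed.

Lemma dim_mod_split A B C m :
  subsp A -> subsp B -> subsp C -> pred_incl B C -> pred_incl C A ->
  dim_mod A B m -> exists p q, [/\ dim_mod A C p, dim_mod C B q & m = (p + q)%N].
Proof.
move=> sA sB sC BC CA dAB.
have [p dp] : exists p, dim_mod A C p.
  apply: (@dim_mod_exists _ _ m) => n s [As inds]; apply: dAB.2; split=> //.
  by move=> c /BC; apply: inds.
have [q dq] : exists q, dim_mod C B q.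
  apply: (@dim_mod_exists _ _ m) => n s [Cs inds].
  apply: (dAB.2 _ s); split=> [i|]; [exact: (CA _ (Cs i)) | exact: inds].
by exists p, q; split=> //; apply: (dim_mod_unique dAB); apply: dim_modD dp dq.
Qed.

Lemma dim_mod0 A B : subsp B -> pred_incl A B -> dim_mod A B 0.
Proof.
move=> sB AB; apply: basis_dim_mod => //; exists (fun _ => 0); split.
  by split; [case | move=> c _ []].
by move=> a Aa; exists (fun _ => 0); rewrite big_ord0 subr0; apply: AB.
Qed.

End OneSpace.

(** The three conditions on [f] say that it induces an isomorphism from A/B to A'/B'. *)
Lemma dim_mod_iso (V W : lmodType k) (f : {linear V -> W})
    (A B : V -> Prop) (A' B' : W -> Prop) m :
  subsp A -> subsp B -> subsp B' ->
  (forall v, A v -> A' (f v)) ->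
  (forall v, A v -> (B' (f v) <-> B v)) ->
  (forall w, A' w -> exists2 v, A v & B' (w - f v)) ->
  dim_mod A B m -> dim_mod A' B' m.
Proof.
move=> sA sB sB' fA fB surj /(dim_mod_basis sA sB)[s [[As inds] span]].
apply: basis_dim_mod => //; exists (fun i => f (s i)).
have E c : \sum_(i < m) c i *: f (s i) = f (\sum_(i < m) c i *: s i).
  by rewrite linear_sum; apply: eq_bigr => i _; rewrite linearZ.
split; first split=> [i|c]; first exact: fA.
  by rewrite E => /fB-/(_ (subsp_comb _ sA As)); apply: inds.
move=> w /surj[v Av Bv]; have [c Bc] := span v Av; exists c.
rewrite E -[w](subrK (f v)) -addrA -raddfB; apply: subspD => //.
by apply/fB => //; apply: subspB => //; apply: subsp_comb.
Qed.

End Dimension.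

(** * The graded Koszul complex *)

(** First isomorphism theorem in one degree: chains modulo cycles are boundaries modulo [N].
    Boundaries allow arbitrary preimages; applying the projections replaces [v] by its homogeneous
    part [prV v]. *)
Lemma dim_mod_image (k : fieldType) (V W : lmodType k) (f : {linear V -> W})
    (prV : {linear V -> V}) (prW : {linear W -> W}) (N : W -> Prop) m :
  subsp N -> (forall v, prW (f v) = f (prV v)) -> (forall v, prV (prV v) = prV v) ->
  (forall w, N w -> N (prW w)) ->
  dim_mod (fun v => prV v = v) (fun v => prV v = v /\ N (f v)) m ->
  dim_mod (fun w => prW w = w /\ exists v, N (w - f v)) (fun w => prW w = w /\ N w) m.
Proof.
move=> sN pf pp pN; apply: (@dim_mod_iso _ _ _ f).
- by split=> [|c u v Eu Ev]; rewrite ?raddf0 // linearP Eu Ev.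
- split=> [|c u v [Eu Nu] [Ev Nv]]; first by rewrite !raddf0; split=> //; case: sN.
  by rewrite !linearP Eu Ev; split=> //; case: sN => _; apply.
- split=> [|c u v [Eu Nu] [Ev Nv]]; first by rewrite !raddf0; split=> //; case: sN.
  by rewrite linearP Eu Ev; split=> //; case: sN => _; apply.
- move=> v Ev; rewrite pf Ev; split=> //; exists v; rewrite subrr.
  by case: sN.
- by move=> v Ev; rewrite pf Ev; split=> [[_ Nv]|[_ Nv]].
- move=> w [Ew [v /pN Nv]]; exists (prV v) => //.
  by rewrite raddfB /= pf Ew in Nv; rewrite raddfB /= Ew pf pp.
Qed.

Section Koszul.
Variable k : fieldType.
Local Notation R := {mpoly k[3]}.
Local Notation V3 := {ffun 'I_3 -> R}.

(** Projection onto the degree j part of the twist R(-i). The case j < i is separate because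
    truncated subtraction would select degree 0. Fixed points of these projections serve as the
    graded pieces below. *)
Definition hcz (j i : nat) (p : R) : R := if (j < i)%N then 0 else hcomp (j - i) p.
Definition hczv (j i : nat) (v : V3) : V3 := [ffun t => hcz j i (v t)].

Arguments hcz (j i)%_N p.
Arguments hczv (j i)%_N v.

Lemma mcoeff_hcz j i p m : (hcz j i p)@_m = if (mdeg m + i == j)%N then p@_m else 0.
Proof.
rewrite /hcz; case: ltnP => [lji|lij].
  by rewrite mcoeff0 ifF //; lia.
rewrite mcoeff_hcomp; congr (if _ then _ else _); lia.
Qed.

Lemma hcz_linear j i : linear (hcz j i).
Proof.
move=> c p q; apply/mpolyP => m; rewrite mcoeffD mcoeffZ !mcoeff_hcz mcoeffD mcoeffZ.
by case: ifP => // _; rewrite mulr0 addr0.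
Qed.
HB.instance Definition _ j i := GRing.isLinear.Build k R R _ (hcz j i) (hcz_linear j i).

Lemma hczv_linear j i : linear (hczv j i).
Proof. by move=> c u v; apply/ffunP => t; rewrite !ffunE linearP. Qed.
HB.instance Definition _ j i := GRing.isLinear.Build k V3 V3 _ (hczv j i) (hczv_linear j i).

Lemma hcz_idem j i p : hcz j i (hcz j i p) = hcz j i p.
Proof. by apply/mpolyP => m; rewrite !mcoeff_hcz; case: eqP. Qed.

Lemma hczv_idem j i v : hczv j i (hczv j i v) = hczv j i v.
Proof. by apply/ffunP => t; rewrite !ffunE hcz_idem. Qed.

Lemma mcoeffXM (l : 'I_3) (p : R) m :
  ('X_l * p)@_m = if (U_(l) <= m)%MM then p@_(m - U_(l)) else 0.
Proof.
case: ifP => [le|nle].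
  by rewrite -{1}(submK le) addmC mulrC mcoeffMX.
apply/eqP; rewrite mcoeff_eq0; apply: contraFN nle.
move=> /msuppM_le /allpairsP[[m1 m2] /= [m1X _ ->]].
by move: m1X; rewrite msuppX inE => /eqP->; apply: lem_addr.
Qed.

Lemma hcz_mulX (l : 'I_3) j i (p : R) : hcz j i ('X_l * p) = 'X_l * hcz j i.+1 p.
Proof.
apply/mpolyP => m; rewrite mcoeff_hcz !mcoeffXM mcoeff_hcz.
case: (boolP (U_(l) <= m)%MM) => [le|_]; last by rewrite if_same.
by congr (if _ then _ else _); rewrite -{1}(submK le) mdegD mdeg1; lia.
Qed.

Lemma homP d (p : R) : Defs.hom d p <-> forall m, m \in msupp p -> mdeg m = d.
Proof. by split=> [/dhomogP|H]; last apply/dhomogP. Qed.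

Lemma hcz_id j i p : (i <= j)%N -> (hcz j i p = p <-> Defs.hom (j - i) p).
Proof.
move=> lij; rewrite homP; split=> [E m|H].
  rewrite mcoeff_msupp -E mcoeff_hcz.
  by have [<-|_] := eqVneq (mdeg m + i)%N j; rewrite ?addnK ?eqxx.
apply/mpolyP => m; rewrite mcoeff_hcz; case: eqP => // ne.
by apply/esym/eqP; rewrite mcoeff_eq0; apply/negP => /H; lia.
Qed.

Lemma hczv_id j i v : (i <= j)%N -> (hczv j i v = v <-> homv (j - i) v).
Proof.
move=> lij; split=> [E t|H].
  by apply/hcz_id => //; rewrite -[in RHS]E ffunE.
by apply/ffunP => t; rewrite ffunE; apply/hcz_id.
Qed.

Lemma hcz_gt j i p : (j < i)%N -> hcz j i p = p -> p = 0.
Proof. by rewrite /hcz => ->. Qed.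

Lemma hczv_gt j i v : (j < i)%N -> hczv j i v = v -> v = 0.
Proof.
move=> lji E; apply/ffunP => t; rewrite [RHS]ffunE; apply: (@hcz_gt j i) => //.
by rewrite -[in RHS]E ffunE.
Qed.

Lemma trE (a b c : R) :
  (tr a b c ord0 = a) * (tr a b c (inord 1) = b) * (tr a b c ord_max = c).
Proof. by rewrite /tr !ffunE /= inordK. Qed.

Lemma ffun_combE (c : k) (u v : V3) t : (c *: u + v) t = c *: u t + v t.
Proof. by rewrite !ffunE. Qed.

Lemma kd1_linear : linear (@kd1 k).
Proof.
move=> a u v; rewrite /kd1 /c0 /c1 /c2 !ffun_combE -!mul_mpolyC; ring.
Qed.
HB.instance Definition _ := GRing.isLinear.Build k V3 R _ (@kd1 k) kd1_linear.

Lemma kd2_linear : linear (@kd2 k).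
Proof.
move=> a u v; apply/ffunP; apply: I3P; rewrite !ffun_combE /kd2 !trE /c0 /c1 /c2
  !ffun_combE -!mul_mpolyC; ring.
Qed.
HB.instance Definition _ := GRing.isLinear.Build k V3 V3 _ (@kd2 k) kd2_linear.

Lemma kd3_linear : linear (@kd3 k).
Proof.
move=> a u v; apply/ffunP; apply: I3P; rewrite !ffun_combE /kd3 !trE -!mul_mpolyC; ring.
Qed.
HB.instance Definition _ := GRing.isLinear.Build k R V3 _ (@kd3 k) kd3_linear.

Lemma kd12 u : kd1 (kd2 u) = 0 :> R.
Proof. by rewrite /kd1 /kd2 /c0 /c1 /c2 !trE; ring. Qed.

Lemma kd23 w : kd2 (kd3 w) = 0 :> V3.
Proof.
apply/ffunP; apply: I3P; rewrite [RHS]ffunE /kd2 /kd3 /c0 /c1 /c2 !trE; ring.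
Qed.

Lemma hczvE j i (v : V3) t : hczv j i v t = hcz j i (v t).
Proof. by rewrite ffunE. Qed.

Lemma hcz_kd1 j v : hcz j 0 (kd1 v) = kd1 (hczv j 1 v).
Proof. by rewrite /kd1 !raddfD /= !hcz_mulX /c0 /c1 /c2 !hczvE. Qed.

Lemma hcz_kd2 j v : hczv j 1 (kd2 v) = kd2 (hczv j 2 v).
Proof.
by apply/ffunP; apply: I3P; rewrite !hczvE /kd2 !trE ?raddfB ?raddfD ?raddfN /=
  !hcz_mulX /c0 /c1 /c2 !hczvE.
Qed.

Lemma hcz_kd3 j w : hczv j 2 (kd3 w) = kd3 (hcz j 3 w).
Proof.
by apply/ffunP; apply: I3P; rewrite !hczvE /kd3 !trE ?raddfN /= !hcz_mulX.
Qed.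

End Koszul.

Arguments hcz {k} (j i)%_N p.
Arguments hczv {k} (j i)%_N v.

(** * Closure properties of subspaces *)

Section Subspaces.
Variables (k : fieldType) (V W : lmodType k).

Lemma subsp_and (A B : V -> Prop) :
  subsp A -> subsp B -> subsp (fun v => A v /\ B v).
Proof.
move=> [A0 AZ] [B0 BZ]; split=> // c u v [Au Bu] [Av Bv].
by split; [apply: AZ | apply: BZ].
Qed.

Lemma subsp_preim (f : {linear V -> W}) (B : W -> Prop) :
  subsp B -> subsp (fun v => B (f v)).
Proof.
by move=> [B0 BZ]; split=> [|c u v Bu Bv]; rewrite ?raddf0 // linearP; apply: BZ.
Qed.

Lemma subsp_fix (f : {linear V -> V}) : subsp (fun v => f v = v).
Proof. by split=> [|c u v Eu Ev]; rewrite ?raddf0 // linearP Eu Ev. Qed.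

Lemma subsp_ext (A A' : V -> Prop) :
  subsp A -> (forall v, A v <-> A' v) -> subsp A'.
Proof.
move=> [A0 AZ] E; split=> [|c u v /E Au /E Av]; first exact/E.
by apply/E; apply: AZ.
Qed.

Lemma subsp_coset (f : {linear W -> V}) (B : V -> Prop) :
  subsp B -> subsp (fun v => exists w, B (v - f w)).
Proof.
move=> [B0 BZ]; split=> [|c u v [w Bu] [w' Bv]].
  by exists 0; rewrite raddf0 subr0.
exists (c *: w + w'); rewrite linearP opprD addrACA -scalerBr; exact: BZ.
Qed.

End Subspaces.

(** * Euler characteristic of the Koszul strands *)

Section KoszulEuler.
Variable k : fieldType.
Local Notation R := {mpoly k[3]}.
Local Notation V3 := {ffun 'I_3 -> R}.
Variable J : R -> Prop.
Hypothesis hJ : homog_ideal J.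
Hypothesis J1 : ~ J 1.

Let subsp_J : subsp J.
Proof.
case: hJ => iJ _; split=> [|c u v Ju Jv]; first by case: iJ.
by case: (iJ) => _ [+ _]; apply=> //; apply: is_idealZ.
Qed.

Let JV (v : V3) : Prop := forall t, J (v t).

Let subsp_JV : subsp JV.
Proof.
split=> [t|c u v Ju Jv t]; first by rewrite ffunE; case: subsp_J.
by rewrite ffun_combE; case: subsp_J => _; apply.
Qed.

Let JMl a p : J p -> J (a * p).
Proof. by case: hJ => [[_ [_ +]] _]; apply. Qed.

Let J_hcz j i p : J p -> J (hcz j i p).
Proof.
rewrite /hcz; case: ifP => _ Jp; first by case: subsp_J.
by case: hJ => _; apply.
Qed.

Let JV_hczv j i v : JV v -> JV (hczv j i v).
Proof. by move=> Jv t; rewrite hczvE; apply: J_hcz. Qed.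

Let JV_tr a b c : J a -> J b -> J c -> JV (tr a b c).
Proof. by move=> Ja Jb Jc; apply: I3P; rewrite trE. Qed.

Let J_kd1 v : JV v -> J (kd1 v).
Proof.
by move=> Jv; rewrite /kd1; do 2?[apply: (subspD subsp_J)]; apply: JMl; apply: Jv.
Qed.

Let JV_kd2 v : JV v -> JV (kd2 v).
Proof.
move=> Jv; have JX a t : J (a * v t) by apply: JMl.
have JN a t : J (- (a * v t)) by apply: is_idealN => //; case: hJ.
by apply: JV_tr; [apply: (subspB subsp_J) | apply: (subspD subsp_J)
  | apply: (subspD subsp_J)]; rewrite /c0 /c1 /c2.
Qed.

Let JV_kd3 w : J w -> JV (kd3 w).
Proof.
move=> Jw; apply: JV_tr; try exact: JMl.
by apply: is_idealN; [case: hJ | apply: JMl].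
Qed.

(** The value at j - i of [h] extended by zero to negative degrees. *)
Definition shift_at (h : nat -> nat) j i := if (j < i)%N then 0%N else h (j - i)%N.

Arguments shift_at h (j i)%_N.

Let dim_K h j i : ((i <= j)%N -> hilb J (j - i) (h (j - i)%N)) ->
  dim_mod (fun p : R => hcz j i p = p) (fun p => hcz j i p = p /\ J p) (shift_at h j i).
Proof.
rewrite /shift_at; case: ltnP => [lji _|lij /(_ isT) dJ].
  apply: dim_mod0; first by apply: subsp_and => //; apply: subsp_fix.
  by move=> p Ep; split=> //; rewrite (hcz_gt lji Ep); case: subsp_J.
apply: dim_mod_ext dJ.
- split=> [|c u v]; first by apply/homP => m; rewrite msupp0.
  by move=> /(hcz_id _ lij) Eu /(hcz_id _ lij) Ev; apply/hcz_id => //; rewrite linearP /= Eu Ev.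
- by move=> v; rewrite hcz_id.
- by move=> v hv; split=> [|[]] //; split=> //; apply/hcz_id.
Qed.

(** The triples are filtered by requiring the first, the first two, then all three coordinates to
    lie in [J]; each layer is a copy of R/J in the given degree. *)
Let dim_KV j i m :
  dim_mod (fun p : R => hcz j i p = p) (fun p => hcz j i p = p /\ J p) m ->
  dim_mod (fun v : V3 => hczv j i v = v) (fun v => hczv j i v = v /\ JV v) (m + (m + m)).
Proof.
move=> dm.
pose F (P : V3 -> Prop) v := hczv j i v = v /\ P v.
have sF P : subsp P -> subsp (F P).
  by move=> sP; apply: subsp_and => //; apply: subsp_fix.
have sJ t : subsp (fun v : V3 => J (v t)).
  split=> [|c u v Ju Jv]; first by rewrite ffunE; case: subsp_J.
  by rewrite ffun_combE; case: subsp_J => _; apply.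
pose A1 := F (fun v => J (v ord0)).
pose A2 := F (fun v => J (v ord0) /\ J (v (inord 1))).
have sA1 : subsp A1 by apply/sF/sJ.
have sA2 : subsp A2 by apply/sF/subsp_and; apply: sJ.
have sA3 : subsp (F JV) by apply/sF.
have sK : subsp (fun v : V3 => hczv j i v = v) by apply: subsp_fix.
have sKJ : subsp (fun p => hcz j i p = p /\ J p).
  by apply: subsp_and => //; apply: subsp_fix.
have J0 : J 0 by case: subsp_J.
have fixv (v : V3) t : hczv j i v = v -> hcz j i (v t) = v t.
  by move=> {2}<-; rewrite hczvE.
have fixt a b c : hcz j i a = a -> hcz j i b = b -> hcz j i c = c ->
    hczv j i (tr a b c) = tr a b c.
  by move=> Ea Eb Ec; apply/ffunP; apply: I3P; rewrite hczvE !trE.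
have fix0 : hcz j i (0 : R) = 0 by rewrite raddf0.
have fixB u v : hczv j i u = u -> hczv j i v = v -> hczv j i (u - v) = u - v.
  by move=> Eu Ev; rewrite raddfB /= Eu Ev.
have BE (u v : V3) t : (u - v) t = u t - v t by rewrite !ffunE.
pose t1 p : V3 := tr p 0 0. pose t2 p : V3 := tr 0 p 0. pose t3 p : V3 := tr 0 0 p.
have l1 : linear t1 by move=> c u v; apply/ffunP; apply: I3P;
  rewrite ffun_combE !trE ?scaler0 ?addr0.
have l2 : linear t2 by move=> c u v; apply/ffunP; apply: I3P;
  rewrite ffun_combE !trE ?scaler0 ?addr0.
have l3 : linear t3 by move=> c u v; apply/ffunP; apply: I3P;
  rewrite ffun_combE !trE ?scaler0 ?addr0.
pose T1 : {linear R -> V3} := HB.pack t1 (GRing.isLinear.Build k R V3 _ t1 l1).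
pose T2 : {linear R -> V3} := HB.pack t2 (GRing.isLinear.Build k R V3 _ t2 l2).
pose T3 : {linear R -> V3} := HB.pack t3 (GRing.isLinear.Build k R V3 _ t3 l3).
have d1 : dim_mod (fun v : V3 => hczv j i v = v) A1 m.
  apply: (@dim_mod_iso _ _ _ T1) dm => //=; first exact: subsp_fix.
  - by move=> p Ep; apply: fixt.
  - move=> p Ep; split=> [[_]|[_ Jp]]; first by rewrite trE.
    by split; [apply: fixt | rewrite trE].
  - move=> v Ev; exists (v ord0); first exact: fixv.
    by split; [apply: fixB => //; apply: fixt; rewrite ?fixv | rewrite BE trE subrr].
have d2 : dim_mod A1 A2 m.
  apply: (@dim_mod_iso _ _ _ T2) dm => //=; first exact: subsp_fix.
  - by move=> p Ep; split; [apply: fixt | rewrite trE].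
  - move=> p Ep; split=> [[_ [_]]|[_ Jp]]; first by rewrite trE.
    by split; [apply: fixt | rewrite !trE].
  - move=> v [Ev Jv]; exists (v (inord 1)); first exact: fixv.
    split; first by apply: fixB => //; apply: fixt; rewrite ?fixv.
    by rewrite !BE !trE subrr subr0.
have d3 : dim_mod A2 (F JV) m.
  apply: (@dim_mod_iso _ _ _ T3) dm => //=; first exact: subsp_fix.
  - by move=> p Ep; split; [apply: fixt | rewrite !trE].
  - move=> p Ep; split=> [[_ /(_ ord_max)]|[_ Jp]]; first by rewrite trE.
    by split; [apply: fixt | apply: JV_tr].
  - move=> v [Ev [Jv1 Jv2]]; exists (v ord_max); first exact: fixv.
    split; first by apply: fixB => //; apply: fixt; rewrite ?fixv.
    by apply: I3P; rewrite !BE !trE ?subrr ?subr0.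
apply: dim_modD d1 _ => //; first by move=> v [Ev Jv]; split.
- by move=> v [].
- apply: dim_modD d2 d3 => //; first by move=> v [Ev Jv]; split.
  by move=> v [Ev []].
Qed.

(** The strand in degree j involves R/J only in degrees j to j-3, so the values below j yield both
    the existence and the value of the dimension in degree j. The alternating sum is arranged to
    avoid subtraction of naturals. *)
Lemma koszul_euler h j b1 b2 b3 :
  (forall d, (d < j)%N -> hilb J d (h d)) ->
  betti J 1%N j b1 -> betti J 2%N j b2 -> betti J 3%N j b3 ->
  exists m, hilb J j m /\
    (m + 3 * shift_at h j 2 + b1 + b3
     = (j == 0) + 3 * shift_at h j 1 + shift_at h j 3 + b2)%N.
Proof.
move=> hilb_lt be1 be2 be3.
have dK i : (0 < i)%N -> dim_mod (fun p : R => hcz j i p = p)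
    (fun p => hcz j i p = p /\ J p) (shift_at h j i).
  by move=> i0; apply: dim_K => lij; apply: hilb_lt; lia.
have dK3 := dK 3%N isT; have dK2 := dim_KV (dK 2%N isT); have dK1 := dim_KV (dK 1%N isT).
have fx i : subsp (fun p : R => hcz j i p = p) by apply: subsp_fix.
have fv i : subsp (fun v : V3 => hczv j i v = v) by apply: subsp_fix.
(* [Z] and [B] are the cycles and boundaries modulo [J] in degree j, and [Js], [Jv] the part of [J]
   in the same strand; thus B_i contains J and Z_i / B_i has dimension b_i. *)
pose Z3 w := hcz j 3 w = w /\ JV (kd3 w).
pose Z2 u := hczv j 2 u = u /\ JV (kd2 u).
pose Z1 v := hczv j 1 v = v /\ J (kd1 v).
pose B2 u := hczv j 2 u = u /\ exists w, JV (u - kd3 w).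
pose B1 v := hczv j 1 v = v /\ exists w, JV (v - kd2 w).
pose B0 (p : R) := hcz j 0 p = p /\ exists w, J (p - kd1 w).
have sZ3 : subsp Z3 by apply: subsp_and => //; apply: subsp_preim.
have sZ2 : subsp Z2 by apply: subsp_and => //; apply: subsp_preim.
have sZ1 : subsp Z1 by apply: subsp_and => //; apply: subsp_preim.
have sB2 : subsp B2 by apply: subsp_and => //; apply: subsp_coset.
have sB1 : subsp B1 by apply: subsp_and => //; apply: subsp_coset.
have sB0 : subsp B0 by apply: subsp_and => //; apply: subsp_coset.
pose Js i (p : R) := hcz j i p = p /\ J p.
pose Jv i (v : V3) := hczv j i v = v /\ JV v.
have sJs i : subsp (Js i) by apply: subsp_and.
have sJv i : subsp (Jv i) by apply: subsp_and.
have d3 : dim_mod Z3 (Js 3%N) b3.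
  move: be3; rewrite /betti; case: ltnP => [lt ->|le].
    apply: dim_mod0; first exact: sJs.
    by move=> w [Ew Jw]; split=> //; rewrite (hcz_gt lt Ew); case: subsp_J.
  apply: dim_mod_ext.
  - by apply: (subsp_ext sZ3) => v; rewrite /Z3 hcz_id.
  - by move=> v; rewrite /Z3 hcz_id.
  - by move=> v [hv Jw]; rewrite /Js hcz_id.
have d2 : dim_mod Z2 B2 b2.
  move: be2; rewrite /betti; case: ltnP => [lt ->|le].
    apply: dim_mod0; first exact: sB2.
    move=> u [Eu _]; split=> //; exists 0.
    by rewrite raddf0 subr0 (hczv_gt lt Eu); case: subsp_JV.
  apply: dim_mod_ext.
  - by apply: (subsp_ext sZ2) => v; rewrite /Z2 hczv_id.
  - by move=> v; rewrite /Z2 hczv_id.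
  - by move=> v [hv Jw]; rewrite /B2 hczv_id.
have d1 : dim_mod Z1 B1 b1.
  move: be1; rewrite /betti; case: ltnP => [lt ->|le].
    apply: dim_mod0; first exact: sB1.
    move=> u [Eu _]; split=> //; exists 0.
    by rewrite raddf0 subr0 (hczv_gt lt Eu); case: subsp_JV.
  apply: dim_mod_ext.
  - by apply: (subsp_ext sZ1) => v; rewrite /Z1 hczv_id.
  - by move=> v; rewrite /Z1 hczv_id.
  - by move=> v [hv Jw]; rewrite /B1 hczv_id.
(* H_0 is R/(J + (x, y, z)) = k, concentrated in degree 0. *)
have d0 : dim_mod (fun p : R => hcz j 0 p = p) B0 (j == 0%N).
  have [j0|jpos] := posnP j; last first.
    apply: dim_mod0; first exact: sB0.
    move=> p Ep; split=> //.
    have [|a [b [c Ec]]] := @mcoeff0_lincomb _ p.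
      by rewrite -Ep mcoeff_hcz mdeg0 ltn_eqF.
    exists (tr a b c); rewrite /kd1 /Defs.c0 /Defs.c1 /Defs.c2 !trE Ec.
    by rewrite ![_ * vx k]mulrC ![_ * vy k]mulrC ![_ * vz k]mulrC subrr; case: subsp_J.
  apply: basis_dim_mod; first exact: sB0.
  have fix1 : hcz j 0 (1 : R) = 1.
    by apply/hcz_id => //; apply/homP => m; rewrite msupp1 inE => /eqP->; rewrite mdeg0 j0.
  exists (fun _ => 1); split; first split=> // c.
    (* Projecting to degree 0 kills the boundary [kd1 w], so a nonzero scalar would lie in [J]. *)
    rewrite big_ord1 => -[_ [w /(J_hcz j 0)]].
    rewrite raddfB /= linearZ /= fix1 hcz_kd1.
    rewrite (@hczv_gt _ j 1 (hczv j 1 w)) ?hczv_idem ?j0 // raddf0 subr0 => Jc i.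
    rewrite (ord1 i); apply/eqP/negPn/negP => cn0; apply: J1.
    rewrite -[1](scalerK cn0); apply: is_idealZ => //; by case: hJ.
  move=> p Ep; exists (fun _ => p@_0%MM); rewrite big_ord1.
  rewrite (_ : p - _ = 0); first by case: sB0.
  apply/eqP; rewrite subr_eq0; apply/eqP/mpolyP => m; rewrite mcoeffZ mcoeff1.
  have [->|mn0] := eqVneq m 0%MM; first by rewrite mulr1.
  by rewrite -Ep mcoeff_hcz addn0 j0 mdeg_eq0 (negPf mn0) mulr0.
(* Rank counting from the left end: p_i is the rank of the i-th differential modulo [J], hence also
   the dimension of B_(i-1) over J, and q_i is the dimension of Z_i over J. *)
have [p3 [q3 [dp3 dq3 E3]]] : exists p q, [/\ dim_mod (fun p : R => hcz j 3 p = p) Z3 p,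
    dim_mod Z3 (Js 3%N) q & shift_at h j 3 = (p + q)%N].
  apply: (dim_mod_split (fx 3%N) (sJs 3%N) sZ3 _ _ dK3); last by move=> w [].
  by move=> w [Ew Jw]; split=> //; apply: JV_kd3.
have db2 : dim_mod B2 (Jv 2%N) p3.
  by apply: (@dim_mod_image _ _ _ (@kd3 k) (hcz j 3) (hczv j 2)) dp3 => //;
    [apply: hcz_kd3 | apply: hcz_idem | apply: JV_hczv].
have dz2 : dim_mod Z2 (Jv 2%N) (b2 + p3).
  apply: (dim_modD sZ2 (sJv 2%N) sB2 _ _ d2 db2).
    by move=> v [Ev Jw]; split=> //; exists 0; rewrite raddf0 subr0.
  move=> v [Ev [w Jw]]; split=> //.
  by rewrite -[v](subrK (kd3 w)) raddfD /= kd23 addr0; apply: JV_kd2.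
have [p2 [q2 [dp2 dq2 E2]]] : exists p q, [/\ dim_mod (fun v : V3 => hczv j 2 v = v) Z2 p,
    dim_mod Z2 (Jv 2%N) q & (shift_at h j 2 + (shift_at h j 2 + shift_at h j 2) = p + q)%N].
  apply: (dim_mod_split (fv 2%N) (sJv 2%N) sZ2 _ _ dK2); last by move=> w [].
  by move=> w [Ew Jw]; split=> //; apply: JV_kd2.
have db1 : dim_mod B1 (Jv 1%N) p2.
  by apply: (@dim_mod_image _ _ _ (@kd2 k) (hczv j 2) (hczv j 1)) dp2 => //;
    [apply: hcz_kd2 | apply: hczv_idem | apply: JV_hczv].
have dz1 : dim_mod Z1 (Jv 1%N) (b1 + p2).
  apply: (dim_modD sZ1 (sJv 1%N) sB1 _ _ d1 db1).
    by move=> v [Ev Jw]; split=> //; exists 0; rewrite raddf0 subr0.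
  move=> v [Ev [w Jw]]; split=> //.
  by rewrite -[v](subrK (kd2 w)) raddfD /= kd12 addr0; apply: J_kd1.
have [p1 [q1 [dp1 dq1 E1]]] : exists p q, [/\ dim_mod (fun v : V3 => hczv j 1 v = v) Z1 p,
    dim_mod Z1 (Jv 1%N) q & (shift_at h j 1 + (shift_at h j 1 + shift_at h j 1) = p + q)%N].
  apply: (dim_mod_split (fv 1%N) (sJv 1%N) sZ1 _ _ dK1); last by move=> w [].
  by move=> w [Ew Jw]; split=> //; apply: J_kd1.
have db0 : dim_mod B0 (Js 0%N) p1.
  by apply: (@dim_mod_image _ _ _ (@kd1 k) (hczv j 1) (hcz j 0)) dp1 => //;
    [apply: hcz_kd1 | apply: hczv_idem | apply: J_hcz].
have dz0 : dim_mod (fun p : R => hcz j 0 p = p) (Js 0%N) ((j == 0%N) + p1).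
  apply: (dim_modD (fx 0%N) (sJs 0%N) sB0 _ _ d0 db0); last by move=> p [].
  by move=> v [Ev Jw]; split=> //; exists 0; rewrite raddf0 subr0.
exists ((j == 0%N) + p1)%N; split.
  apply: dim_mod_ext dz0 => //.
  - by move=> p; rewrite hcz_id // subn0.
  - by move=> p Ep; split=> [[]|Jp].
(* Here q3 = b3, q2 = b2 + p3 and q1 = b1 + p2; eliminating the ranks gives the identity. *)
have := dim_mod_unique dq3 d3; have := dim_mod_unique dq2 dz2.
have := dim_mod_unique dq1 dz1; lia.
Qed.

End KoszulEuler.

(** * The Hilbert function *)

Section StandardMonomials.
Variables (k : fieldType) (ts : seq (nat * nat * nat)) (A B C : nat).
Local Notation T := ('I_A * 'I_B * 'I_C)%type.
Hypothesis bounded : forall u v w, ~~ covers ts (u, v, w) ->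
  [&& (u < A)%N, (v < B)%N & (w < C)%N].

Definition triple (t : T) : nat * nat * nat := (val t.1.1, val t.1.2, val t.2).
Definition tdeg (t : T) : nat := (val t.1.1 + val t.1.2 + val t.2)%N.
(** The bounding box makes the standard monomials of degree d a finite set, counted by
    cardinality. *)
Definition std_set (d : nat) : {set T} :=
  [set t | ~~ covers ts (triple t) & tdeg t == d].

Lemma triple_inj : injective triple.
Proof.
by move=> [[a b] c] [[a' b'] c'] [] /val_inj-> /val_inj-> /val_inj->.
Qed.

(** Standard monomials are a basis: their coefficients vanish on the ideal, and removing the
    standard part of a form leaves only covered monomials. *)
Lemma hilb_monoI d : hilb (@monoI k ts) d #|std_set d|.
Proof.
have sI : subsp (@monoI k ts).
  have iI := monoI_ideal k ts.
  split=> [|c u v Iu Iv]; first by case: iI.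
  by case: (iI) => _ [+ _]; apply=> //; apply: (is_idealZ _ iI).
have coefE (c : 'I_#|std_set d| -> k) (i : 'I_#|std_set d|) :
    (\sum_(j < #|std_set d|) c j *: mono k (triple (enum_val j)))@_(expo (triple (enum_val i)))
    = c i.
  rewrite raddf_sum /= (bigD1 i) //= mcoeffZ mcoeffX eqxx mulr1 big1 ?addr0 // => j ji.
  rewrite mcoeffZ mcoeffX; case: eqP => [/expo_inj /triple_inj /enum_val_inj E|_].
    by rewrite E eqxx in ji.
  by rewrite mulr0.
apply: basis_dim_mod => //; exists (fun i => mono k (triple (enum_val i))).
split; first split.
- move=> i; apply/homP => m; rewrite msuppX inE => /eqP->; rewrite mdeg_expo.
  by have := enum_valP i; rewrite inE => /andP[_ /eqP].
- move=> c Ic i; apply/eqP/negPn/negP => ci.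
  have := enum_valP i; rewrite inE => /andP[/negP nc _]; apply: nc.
  by apply: Ic; rewrite coefE.
move=> p /homP hp; exists (fun i => p@_(expo (triple (enum_val i)))) => t.
apply: contraNT => nc; rewrite mcoeffB subr_eq0; apply/eqP.
have [pt|/memN_msupp_eq0 pt] := boolP (expo t \in msupp p); last first.
  rewrite pt raddf_sum /= big1 // => i _.
  rewrite mcoeffZ mcoeffX; case: eqP => [->|_]; last by rewrite mulr0.
  by rewrite pt mul0r.
have := bounded (u := t.1.1) (v := t.1.2) (w := t.2).
rewrite -!surjective_pairing => /(_ nc) /and3P[lA lB lC].
pose t' : T := (Ordinal lA, Ordinal lB, Ordinal lC).
have Et : triple t' = t by rewrite /triple /= -!surjective_pairing.
have t'S : t' \in std_set d.
  by rewrite inE Et nc /=; move/hp: pt; rewrite mdeg_expo /tdeg /= => ->.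
by rewrite -Et -(enum_rankK_in t'S t'S) coefE.
Qed.

Lemma coef_std (d : nat) :
  (\sum_(a < A) \sum_(b < B) \sum_(c < C)
    (if covers ts (val a, val b, val c) then 0 else 'X^(a + b + c)) : {poly int})`_d
  = #|std_set d|%:R.
Proof.
rewrite pair_bigA pair_bigA /= coef_sum -sum1_card natr_sum /=.
rewrite [RHS]big_mkcond; apply: eq_bigr => t _; rewrite inE.
rewrite /triple /tdeg; case: ifP => _ /=; first by rewrite coef0.
by rewrite coefXn eq_sym; case: eqP.
Qed.

End StandardMonomials.

(** * The generating polynomial of the standard monomials of J' *)

Lemma geom_sum p q : (p <= q)%N ->
  (1 - 'X) * (\sum_(p <= i < q) 'X^i) = 'X^p - 'X^q :> {poly int}.
Proof.
move=> pq; rewrite mulr_sumr -[RHS]opprB -telescope_sumr // -sumrN.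
by apply: eq_bigr => i _; rewrite exprS; ring.
Qed.

(** A row of w standard monomials starting in degree s, padded by zeros to the width M of the
    box. *)
Lemma row_sum s w M : (w <= M)%N ->
  (1 - 'X) * (\sum_(c < M) if (c < w)%N then 'X^(s + c) else 0)
  = 'X^s * (1 - 'X^w) :> {poly int}.
Proof.
move=> wM; rewrite -(big_mkord xpredT (fun c => if (c < w)%N then 'X^(s + c) else 0)).
suff -> : \sum_(0 <= c < M) (if (c < w)%N then 'X^(s + c) else 0)
    = 'X^s * \sum_(0 <= c < w) 'X^c :> {poly int} by rewrite mulrCA geom_sum ?expr0.
rewrite (big_cat_nat _ wM) //= [X in _ + X]big1_seq ?addr0; last first.
  by move=> i; rewrite mem_index_iota => /and3P[_ wi _]; rewrite ltnNge wi.
by rewrite mulr_sumr; apply: eq_big_nat => i /andP[_ iw]; rewrite iw exprD.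
Qed.

Definition Jprime_hp n : {poly int} :=
  \sum_(a < 2) \sum_(b < 2 * n + 1) \sum_(c < 2 * n + 4)
    (if covers (Jprime_expo n) (val a, val b, val c) then 0 else 'X^(a + b + c)).

(** The right side is 1 plus the alternating sum of the prescribed Betti numbers; beta_1 and beta_3
    both contribute at 2n+4. Since x^2 is in J', the left side splits into the slices of x-exponent
    0 and 1. *)
Lemma Jprime_hpE n : (4 <= n)%N ->
  (1 - 'X) ^+ 3 * Jprime_hp n =
    1 - 'X^2 - 2 * 'X^(n + 1) - 'X^(n + 3) - 2 * 'X^(2 * n + 4) + 2 * 'X^(n + 2)
    + 'X^(n + 4) + 'X^(2 * n + 3) + 2 * 'X^(2 * n + 6) + 'X^(3 * n + 4)
    - 'X^(2 * n + 7) - 'X^(3 * n + 5).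
Proof.
move=> n4.
(* For x-exponent 0 the z-row over y^b has length 2n+4 when b < n, and length 1 afterwards because
   of y^n z. *)
have row0 : (1 - 'X) ^+ 2 * (\sum_(b < 2 * n + 1) \sum_(c < 2 * n + 4)
      (if covers (Jprime_expo n) (0%N, val b, val c) then 0 else 'X^(0 + b + c)))
    = (1 - 'X^n) * (1 - 'X^(2 * n + 4)) + ('X^n - 'X^(2 * n + 1)) * (1 - 'X) :> {poly int}.
  rewrite expr2 -mulrA mulr_sumr.
  transitivity ((1 - 'X) * (\sum_(0 <= b < 2 * n + 1)
      'X^b * (1 - 'X^(if (b < n)%N then 2 * n + 4 else 1)%N)) : {poly int}).
    congr (_ * _); rewrite big_mkord; apply: eq_bigr => b _; rewrite -(@row_sum _ _ (2 * n + 4)).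
      congr (_ * _); apply: eq_bigr => c _; rewrite add0n -if_neg; congr (if _ then _ else _).
      by have := ltn_ord b; have := ltn_ord c; rewrite /covers /divt /=; case: ifP; lia.
    by case: ifP; lia.
  rewrite (big_cat_nat (n := n)) /=; try lia.
  pose F b : {poly int} := 'X^b * (1 - 'X^(if (b < n)%N then 2 * n + 4 else 1)%N).
  have -> : \sum_(0 <= b < n) F b = (\sum_(0 <= b < n) 'X^b) * (1 - 'X^(2 * n + 4)).
    by rewrite mulr_suml /F; apply: eq_big_nat => i /andP[_ ->].
  have -> : \sum_(n <= b < 2 * n + 1) F b = (\sum_(n <= b < 2 * n + 1) 'X^b) * (1 - 'X).
    rewrite mulr_suml /F; apply: eq_big_nat => i /andP[ni _].
    by rewrite ltnNge ni expr1.
  by rewrite mulrDr !mulrA !geom_sum ?expr0 //; lia.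
(* For x-exponent 1 the length is 2n+4 at b = 0, n+1 for 0 < b < n-1 because of x y z^(n+1), and 1
   from b = n-1 on because of x y^(n-1) z. *)
have row1 : (1 - 'X) ^+ 2 * (\sum_(b < 2 * n + 1) \sum_(c < 2 * n + 4)
      (if covers (Jprime_expo n) (1%N, val b, val c) then 0 else 'X^(1 + b + c)))
    = 'X * ((1 - 'X) * (1 - 'X^(2 * n + 4)) + ('X - 'X^(n - 1)) * (1 - 'X^(n + 1))
       + ('X^(n - 1) - 'X^(2 * n + 1)) * (1 - 'X)) :> {poly int}.
  rewrite expr2 -mulrA mulr_sumr.
  transitivity ((1 - 'X) * (\sum_(0 <= b < 2 * n + 1)
      'X^(1 + b) * (1 - 'X^(if (b == 0) then 2 * n + 4 else
                          if (b < n - 1) then n + 1 else 1)%N)) : {poly int}).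
    congr (_ * _); rewrite big_mkord; apply: eq_bigr => b _; rewrite -(@row_sum _ _ (2 * n + 4)).
      congr (_ * _); apply: eq_bigr => c _; rewrite -if_neg; congr (if _ then _ else _).
      have := ltn_ord b; have := ltn_ord c; rewrite /covers /divt /=.
      by case: eqP; last case: ifP; lia.
    by case: eqP; last case: ifP; lia.
  rewrite big_ltn; last lia.
  rewrite (big_cat_nat (n := n - 1)) /=; try lia.
  pose F b : {poly int} := 'X^(1 + b) * (1 - 'X^(if (b == 0) then 2 * n + 4 else
                          if (b < n - 1) then n + 1 else 1)%N).
  have -> : \sum_(1 <= b < n - 1) F b
      = 'X * (\sum_(1 <= b < n - 1) 'X^b) * (1 - 'X^(n + 1)).
    rewrite mulr_sumr mulr_suml /F; apply: eq_big_nat => i /andP[i0 lin].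
    by rewrite gtn_eqF // lin exprS.
  have -> : \sum_(n - 1 <= b < 2 * n + 1) F b
      = 'X * (\sum_(n - 1 <= b < 2 * n + 1) 'X^b) * (1 - 'X).
    rewrite mulr_sumr mulr_suml /F; apply: eq_big_nat => i /andP[ni _].
    rewrite gtn_eqF; last lia.
    by rewrite ltnNge ni exprS.
  rewrite (_ : (1 - 'X) * _ = 'X * ((1 - 'X) * (1 - 'X^(2 * n + 4)) +
      ((1 - 'X) * (\sum_(1 <= i < n - 1) 'X^i)) * (1 - 'X^(n + 1))
    + ((1 - 'X) * (\sum_(n - 1 <= i < 2 * n + 1) 'X^i)) * (1 - 'X))); last by ring.
  by rewrite !geom_sum ?expr1 //; lia.
rewrite /Jprime_hp !big_ord_recl big_ord0 addr0 exprS -mulrA mulrDr row0 row1.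
(* Writing n = m+1 removes the truncated n-1; every power then becomes a monomial in ['X^m] and
   ['X], and [ring] applies. *)
have [m ->] : exists m, n = m.+1 by exists n.-1; lia.
rewrite subn1 /=.
have pE e a b : (e = a * m + b)%N -> 'X^e = ('X^m) ^+ a * 'X^b :> {poly int}.
  by move=> ->; rewrite exprD mulnC exprM.
rewrite (pE m.+1 1%N 1%N) ?(pE (2 * m.+1 + 1)%N 2%N 3%N) ?(pE (2 * m.+1 + 4)%N 2%N 6%N)
  ?(pE (m.+1 + 1)%N 1%N 2%N) ?(pE (m.+1 + 2)%N 1%N 3%N) ?(pE (m.+1 + 3)%N 1%N 4%N)
  ?(pE (m.+1 + 4)%N 1%N 5%N) ?(pE (2 * m.+1 + 3)%N 2%N 5%N) ?(pE (2 * m.+1 + 6)%N 2%N 8%N)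
  ?(pE (2 * m.+1 + 7)%N 2%N 9%N) ?(pE (3 * m.+1 + 4)%N 3%N 7%N) ?(pE (3 * m.+1 + 5)%N 3%N 8%N);
  try lia.
ring.
Qed.

(** * Comparison with the Hilbert function forced by the Betti table *)

Definition Jprime_hilb n d : nat := #|std_set (Jprime_expo n) 2%N (2 * n + 1)%N (2 * n + 4)%N d|.

(** For n >= 4 the listed degrees in each row are distinct, so the nested conditionals are sums of
    indicators. *)
Lemma betti_tableE n j : (4 <= n)%N ->
  [/\ betti_table n 1%N j
        = ((j == 2) + 2 * (j == n + 1) + (j == n + 3) + (j == 2 * n + 4))%N,
      betti_table n 2%N j
        = (2 * (j == n + 2) + (j == n + 4) + (j == 2 * n + 3) + 2 * (j == 2 * n + 6)
           + (j == 3 * n + 4))%N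
    & betti_table n 3%N j
        = ((j == 2 * n + 4) + (j == 2 * n + 7) + (j == 3 * n + 5))%N].
Proof. by move=> n4; split; rewrite /betti_table; do ![case: eqP => ?]; lia. Qed.

(** The coefficient of t^j in [Jprime_hpE] after expanding (1 - t)^3; it has the shape of the
    identity in [koszul_euler]. *)
Lemma Jprime_hilb_rec n j : (4 <= n)%N ->
  let h := Jprime_hilb n in
  (h j + 3 * shift_at h j 2 + betti_table n 1 j + betti_table n 3%N j
   = (j == 0) + 3 * shift_at h j 1 + shift_at h j 3 + betti_table n 2 j)%N.
Proof.
move=> n4 h; have [-> -> ->] := betti_tableE j n4.
have coefH d : (Jprime_hp n)`_d = h d :> int by rewrite -natz; apply: coef_std.
have shiftE i : ('X^i * Jprime_hp n)`_j = shift_at h j i :> int.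
  by rewrite coefXnM /shift_at; case: ifP => // _; rewrite coefH.
have := congr1 (fun p : {poly int} => p`_j) (Jprime_hpE n4).
have -> : (1 - 'X) ^+ 3 * Jprime_hp n = Jprime_hp n - ('X^1 * Jprime_hp n) *+ 3
    + ('X^2 * Jprime_hp n) *+ 3 - 'X^3 * Jprime_hp n by ring.
rewrite !mulr_natl -[1]/('X^0 : {poly int}).
rewrite !(coefD, coefN, coefMn) !shiftE coefH !coefXn !natz; lia.
Qed.

(** Strong induction on the degree: the recursion for [J] and the one for J' have the same lower
    terms, hence the same value at j. *)
Lemma hilb_of_betti (k : fieldType) n (J : {mpoly k[3]} -> Prop) : (4 <= n)%N ->
  homog_ideal J -> ~ J 1 ->
  (forall i j, (1 <= i)%N -> betti J i j (betti_table n i j)) ->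
  forall d, hilb J d (Jprime_hilb n d).
Proof.
move=> n4 hJ J1 bJ; elim/ltn_ind => j IH.
have [m [dm E]] := koszul_euler hJ J1 IH (bJ 1%N j isT) (bJ 2%N j isT) (bJ 3%N j isT).
by rewrite (_ : Jprime_hilb n j = m) //; have := Jprime_hilb_rec j n4; cbv zeta; lia.
Qed.

(** Stated as an equality of predicates so that it rewrites inside [hilb] and [perfect]. *)
Lemma gen_Jprime (k : fieldType) n : gen (Jprime_gens k n) = monoI (Jprime_expo n).
Proof.
apply: functional_extensionality => f; apply: propositional_extensionality.
by rewrite Jprime_gensE; apply: genE_monoI.
Qed.

Lemma hilb_Jprime (k : fieldType) n d :
  hilb (gen (Jprime_gens k n)) d (Jprime_hilb n d).
Proof.
rewrite gen_Jprime; apply: hilb_monoI => u v w; rewrite /covers /divt /=; lia.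
Qed.

(** * Perfection of J' and the conclusion *)

Lemma subsp_hom (k : fieldType) d : subsp (fun p : {mpoly k[3]} => Defs.hom d p).
Proof.
by split=> [|c u v hu hv]; [apply: dhomog0 | apply: rpredD => //; apply: rpredZ].
Qed.

(* The socle of R/J' contains the class of x y^(2n). *)
Lemma perfect_Jprime (k : fieldType) n : (4 <= n)%N -> perfect (gen (Jprime_gens k n)).
Proof.
move=> n4; have hd := hilb_Jprime k n (2 * n + 1)%N; rewrite gen_Jprime in hd *.
split; first exact: monoI_homog.
exists 3%N; split.
  by apply: (@grade_monoI _ 2%N (2 * n + 1)%N (2 * n + 4)%N); rewrite /covers /divt /=; lia.
split; last first.
  by move=> [|[|[|[|i]]]] // j _; rewrite /betti; case: ifP.
(* The third Betti number in degree 2n+4 counts socle elements of degree 2n+1, the degree of x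
   y^(2n). *)
exists (2 * n + 4)%N; rewrite /betti ltnNge (_ : 3 <= 2 * n + 4)%N /=; last lia.
rewrite (_ : 2 * n + 4 - 3 = 2 * n + 1)%N; last lia.
pose Z (w : {mpoly k[3]}) :=
  Defs.hom (2 * n + 1)%N w /\ forall t, monoI (Jprime_expo n) (kd3 w t).
pose B (w : {mpoly k[3]}) := Defs.hom (2 * n + 1)%N w /\ monoI (Jprime_expo n) w.
(* Socle elements independent modulo J' are independent in the whole degree 2n+1 part of R/J', whose
   dimension is known. *)
have [m dm] : exists m, dim_mod Z B m.
  apply: (@dim_mod_exists _ _ _ _ (Jprime_hilb n (2 * n + 1)%N)) => l s [Zs inds].
  apply: (hd.2 _ s); split=> [i|c Ic]; first by case: (Zs i).
  apply: inds; split=> //; apply: (subsp_comb _ (subsp_hom k _)) => i.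
  by case: (Zs i).
exists m; split=> //.
pose w := mono k (1, 2 * n, 0)%N.
apply: (dm.2 _ (fun _ : 'I_1 => w)); split.
  move=> _; split.
    by apply/homP => m0; rewrite msuppX inE => /eqP->; rewrite mdeg_expo /=; lia.
  have iI := monoI_ideal k (Jprime_expo n).
  have X1 : vx k = mono k (1, 0, 0)%N by rewrite monoE /= !expr0 !mulr1.
  have X2 : vy k = mono k (0, 1, 0)%N by rewrite monoE /= !expr0 mul1r mulr1.
  have X3 : vz k = mono k (0, 0, 1)%N by rewrite monoE /= !expr0 !mul1r.
  (* The products of [w] with x, y and z are multiples of x^2, y^(2n+1) and y^n z respectively. *)
  apply: I3P; rewrite /kd3 trE ?X1 ?X2 ?X3 ?monoD; try apply: (is_idealN iI);
    by rewrite ?monoD monoI_mono /covers /divt /=; lia.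
move=> c; rewrite big_ord1 => -[_ Iw] i; rewrite (ord1 i).
apply/eqP/negPn/negP => c0.
suff : covers (Jprime_expo n) (1, 2 * n, 0)%N by rewrite /covers /divt /=; lia.
apply/(@monoI_mono k); rewrite -[mono _ _](scalerK c0).
exact: (is_idealZ _ (monoI_ideal _ _) Iw).
Qed.

Local Close Scope ring_scope.

Theorem theorem5p4 (k : fieldType) (n : nat) (J : {mpoly k[3]} -> Prop) :
  (4 <= n)%N ->
  homog_ideal J ->
  grade J 3 ->
  (forall i j, (1 <= i)%N -> betti J i j (betti_table n i j)) ->
  SBL (gen (Jprime_gens k n)) /\
  (forall d m, hilb (gen (Jprime_gens k n)) d m <-> hilb J d m).
Proof.
move=> n4 hJ [J1 _] bJ; split.
  by split; [apply: perfect_Jprime | apply: Jprime_links].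
have hJd := hilb_of_betti n4 hJ J1 bJ.
move=> d m; split=> dm.
  by rewrite (dim_mod_unique dm (hilb_Jprime k n d)).
by rewrite (dim_mod_unique dm (hJd d)); apply: hilb_Jprime.
Qed.
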